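(* Let $\mathcal{G}$ be a compact and connected metric graph of total length $L$ whose doubly connected part has a connected component of length $V\in[0,L]$. Let $\mathcal{L}[V]$ be the tadpole graph of total length $L$ whose loop has length $V$. Then $$\lambda_2^N(\mathcal{G})\ge\lambda_2^N(\mathcal{L}[V]).$$
   Context: A compact metric graph has finitely many vertices and edges, each edge $e$ identified with an interval $[0,|e|]$, $0<|e|<\infty$; loops and multiple edges are allowed. All vertices are equipped with natural conditions: functions are continuous at each vertex and the sum of the outward derivatives over all edges at the vertex is zero. For a connected graph, $0=\lambda_1^N<\lambda_2^N\le\lambda_3^N\le\dots$ are the eigenvalues of the Laplacian $-d^2/dx^2$ with these conditions; thus $\lambda_2^N(\mathcal{G})=\inf\{\int_{\mathcal{G}}|f'|^2dx/\int_{\mathcal{G}}|f|^2dx: 0\ne f\in H^1(\mathcal{G}),\ \int_{\mathcal{G}}f\,dx=0\}$, where $H^1(\mathcal{G})$ is the space of continuous functions on $\mathcal{G}$ that are $H^1$ on each edge. The doubly connected part of $\mathcal{G}$ is the closed subgraph consisting of all $x\in\mathcal{G}$ for which there is a non-self-intersecting path in $\mathcal{G}$ starting and ending at $x$; equivalently, it is obtained by deleting every bridge (including pendant edges) and then any isolated vertices. A tadpole graph consists of a loop attached to one end of a single edge; here the edge has length $L-V$, with the degenerate cases of a path of length $L$ ($V=0$) and a loop of length $L$ ($V=L$). *)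

(* Defs.v *)
From HB Require Import structures.
From mathcomp Require Import all_boot all_order all_algebra.
From mathcomp Require Import all_classical all_reals all_analysis.

Set Implicit Arguments.
Unset Strict Implicit.
Unset Printing Implicit Defensive.

Import Order.TTheory GRing.Theory Num.Theory.
Import numFieldNormedType.Exports.

Local Open Scope classical_set_scope.
Local Open Scope ring_scope.

(* The edge [e] is the interval [0, len e], with 0 glued to [src e] and [len e]
   glued to [tgt e]; loops and multiple edges are allowed.  The orientation
   only fixes the parametrization. *)
Record metric_graph (R : realType) := MetricGraph {
  vert : finType;
  edge : finType;
  src : edge -> vert;
  tgt : edge -> vert;
  len : edge -> R;
  len_gt0 : forall e, 0 < len e }.

Section MetricGraphs.
Context {R : realType}.
Implicit Types (G : metric_graph R) (l L V : R).

Definition total_length G : R := \sum_(e : edge G) len e.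

Definition adjacent_via G (A : pred (edge G)) : rel (vert G) := fun x y =>
  [exists e, A e && (((src e == x) && (tgt e == y)) ||
                     ((src e == y) && (tgt e == x)))].

Definition connected_graph G : Prop :=
  (0 < #|vert G|)%N /\ forall x y : vert G, connect (adjacent_via predT) x y.

(* A traversal of an edge: from [src] to [tgt], or backwards if the flag is
   set. *)
Definition dart_src G (d : edge G * bool) : vert G :=
  if d.2 then tgt d.1 else src d.1.
Definition dart_tgt G (d : edge G * bool) : vert G :=
  if d.2 then src d.1 else tgt d.1.

(* The requirement on edges excludes running along an edge and straight back,
   which repeats no vertex. *)
Definition simple_closed_path G (p : seq (edge G * bool)) : bool :=
  [&& cycle (fun d d' => dart_tgt d == dart_src d') p,
      uniq [seq dart_src d | d <- p] & uniq [seq d.1 | d <- p]].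

(* A simple closed path through an interior point of an edge runs along the
   whole edge, so the doubly connected part is a union of closed edges and is
   given by the set of these edges. *)
Definition doubly_connected G : pred (edge G) := fun e =>
  `[< exists2 p, simple_closed_path p & e \in [seq d.1 | d <- p] >].

(* The connected component, in the subgraph made of the edges in [A], of the
   edge [e0]. *)
Definition component G (A : pred (edge G)) (e0 : edge G) : pred (edge G) :=
  fun e => A e && connect (adjacent_via A) (src e0) (src e).

(* Components of the doubly connected part have positive length; the value 0
   is used when the doubly connected part is empty, i.e. when [G] is a tree. *)
Definition doubly_connected_component_length G V : Prop :=
  (exists2 e0, doubly_connected e0 &
     V = \sum_(e | component (@doubly_connected G) e0 e) len e) \/
  ((forall e : edge G, ~~ doubly_connected e) /\ V = 0).

(* [f] is in H^1(0, l), identified with its continuous representative, and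
   [f'] is its derivative, which is determined almost everywhere. *)
Definition H1_interval l (f f' : R -> R) : Prop :=
  [/\ measurable_fun `[0, l] f',
      lebesgue_measure.-integrable `[0, l] (fun t => (f' t ^+ 2)%:E)
    & forall x, x \in `[0, l] ->
        f x = f 0 + \int[lebesgue_measure]_(t in `[0, x]) f' t].

(* A function on [G] is a family of functions on the edges; only the values of
   [f e] on [0, len e] matter. *)
Definition graph_integral G (f : edge G -> R -> R) : R :=
  \sum_e \int[lebesgue_measure]_(t in `[0, len e]) f e t.

Definition H1_graph G (f f' : edge G -> R -> R) : Prop :=
  (forall e, H1_interval (len e) (f e) (f' e)) /\
  (exists u : vert G -> R,
     forall e, f e 0 = u (src e) /\ f e (len e) = u (tgt e)).

Definition rayleigh_quotients G : set R :=
  [set r | exists f f' : edge G -> R -> R,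
     [/\ H1_graph f f',
         exists e, exists2 x, x \in `[0, len e] & f e x != 0,
         graph_integral f = 0
       & r = graph_integral (fun e t => f' e t ^+ 2) /
             graph_integral (fun e t => f e t ^+ 2)]].

(* The second eigenvalue of the Laplacian with natural vertex conditions, for
   connected [G]. *)
Definition lambda2 G : R := inf (rayleigh_quotients G).

Definition path_graph l (l0 : 0 < l) : metric_graph R :=
  @MetricGraph R bool unit (fun=> false) (fun=> true) (fun=> l) (fun=> l0).

Definition loop_graph l (l0 : 0 < l) : metric_graph R :=
  @MetricGraph R unit unit (fun=> tt) (fun=> tt) (fun=> l) (fun=> l0).

(* The edge [true] is a loop of length [v] at the vertex [false]; the edge
   [false] has length [p] and joins the vertices [false] and [true]. *)
Definition proper_tadpole (p v : R) (p0 : 0 < p) (v0 : 0 < v) :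
    metric_graph R :=
  @MetricGraph R bool bool (fun=> false) negb (fun e => if e then v else p)
    (fun e => if e return 0 < (if e then v else p) then v0 else p0).

Lemma tadpole_loop_gt0 L V : 0 <= V <= L -> V != 0 -> 0 < V.
Proof. by move=> /andP[V0 _] Vn0; rewrite lt_neqAle eq_sym Vn0. Qed.

Lemma tadpole_edge_gt0 L V : 0 <= V <= L -> V != L -> 0 < L - V.
Proof. by move=> /andP[_ VL] VnL; rewrite subr_gt0 lt_neqAle VnL. Qed.

Definition tadpole L V (L0 : 0 < L) (VL : 0 <= V <= L) : metric_graph R :=
  match eqVneq V 0, eqVneq V L with
  | EqNotNeq _, _ => path_graph L0
  | NeqNotEq _, EqNotNeq _ => loop_graph L0
  | NeqNotEq V0, NeqNotEq VnL =>
      proper_tadpole (tadpole_edge_gt0 VL VnL) (tadpole_loop_gt0 VL V0)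
  end.

End MetricGraphs.

(* Main.v *)
(** Let [k ^ 2] be the second eigenvalue of the tadpole, given by the secular
    equation [half_phase (k (L - V)) + k V / 2 = pi], where [half_phase] is the
    continuous branch of [atan (tan x / 2)]. The function with this frequency
    on the tadpole bounds its [lambda2] from above.

    For the lower bound on [G], let [f] be a test function and let [[t1, t2]]
    be its range on the given component of the doubly connected part. By
    connectedness [f] takes every level of its range at least once, and, as
    every edge of the component lies on a cycle, almost every level of
    [[t1, t2]] at least twice. Instead of rearranging [f] into a monotone
    function on a path whose middle part is doubled, one calibrates: for
    [w >= 0] one has [f' ^ 2 >= 2 w |f'| - w ^ 2], and with
    [w = k sqrt (B ^ 2 - f ^ 2)] the quantity [w ^ 2 + k ^ 2 f ^ 2] is the
    constant [k ^ 2 B ^ 2], so that only the number of crossings of the levels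
    and the measure of the set of levels matter. If [a], [2 th] and [b] are [k]
    times the measures of [f < t1], [t1 <= f <= t2] and [f > t2], this gives
    [int f' ^ 2 >= k ^ 2 int (f - c) ^ 2] for a suitable quantile [c] as soon as
    [half_phase a + th + half_phase b < pi]. As [half_phase] is superadditive on
    [[0, pi]] and has slope at least [1 / 2], this sum is largest when a single
    pendant edge of length [L - V] remains, that is, for the tadpole. *)

Require Import Defs.
From mathcomp Require Import all_boot all_order all_algebra.
From mathcomp Require Import all_classical all_reals all_analysis.
From mathcomp Require Import measurable_realfun ring lra.
Import Order.TTheory GRing.Theory Num.Theory.
Import numFieldNormedType.Exports.

Set Implicit Arguments.
Unset Strict Implicit.
Unset Printing Implicit Defensive.

Local Open Scope classical_set_scope.
Local Open Scope ring_scope.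

(** * Trigonometry *)
Section Trigo.
Context {R : realType}.
Implicit Types x y a b p q u r h : R.

Lemma nondecreasing_of_deriv (f f' : R -> R) a b :
  (forall x, is_derive x 1 f (f' x)) -> (forall x, a < x < b -> 0 <= f' x) ->
  a <= b -> f a <= f b.
Proof.
move=> df f'0; rewrite le_eqVlt => /predU1P[->//|ab].
have [x xab E] := @MVT R f f' a b ab (fun x _ => df x)
  (@derivable_within_continuous _ _ _ _ (fun x _ =>
    @ex_derive _ _ _ _ _ _ _ (df x))).
rewrite -subr_ge0 E mulr_ge0 ?subr_ge0 ?(ltW ab) // f'0 //.
Qed.

Lemma sin_le_id x : 0 <= x -> sin x <= x.
Proof.
move=> x0; rewrite -subr_ge0.
have : 0 - sin 0 <= x - sin x.
  apply: (@nondecreasing_of_deriv (fun x => x - sin x) (fun x => 1 - cos x)) => //.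
by rewrite sin0 subr0.
Qed.

Lemma id_cos_le_sin x : 0 <= x -> x <= pi -> x * cos x <= sin x.
Proof.
move=> x0 xpi; rewrite -subr_ge0.
have : sin 0 - 0 * cos 0 <= sin x - x * cos x.
  apply: (@nondecreasing_of_deriv (fun x => sin x - x * cos x)
    (fun x => x * sin x) 0 x _ _ x0).
  - move=> y; apply: is_derive_eq; rewrite /GRing.scale /=; ring.
  - by move=> y /andP[y0 yx]; rewrite mulr_ge0 ?sin_ge0_pi ?ltW // (lt_le_trans yx).
by rewrite sin0 mul0r subr0.
Qed.

Lemma sin_lipschitz x y : x <= y -> `|sin y - sin x| <= y - x.
Proof.
move=> xy; rewrite ler_norml; apply/andP; split.
- have : x + sin x <= y + sin y; last lra.
  exact: (@nondecreasing_of_deriv (fun z => z + sin z) (fun z => 1 + cos z)).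
- have : x - sin x <= y - sin y; last lra.
  exact: (@nondecreasing_of_deriv (fun z => z - sin z) (fun z => 1 - cos z)).
Qed.

(** For [r < pi / 2], the function [tan u * cos r ^+ 2 - u] of [u] is smallest at [u = r], where
    equality holds. This absorbs the difference between the angle at which a level is reached and
    the angle measured by mass. *)
Lemma tangent_gap r u : 0 <= r <= pi / 2 -> 0 <= u < pi / 2 ->
  u + sin r * cos r <= r + tan u * cos r ^+ 2.
Proof.
move=> /andP[r0 rpi] /andP[u0 upi].
have pi0 := pi_gt0 R.
have cu : 0 < cos u by apply: cos_gt0_pihalf; lra.
have cr : 0 <= cos r by apply: cos_ge0_pihalf; lra.
have su : 0 <= sin u by apply: sin_ge0_pi; lra.
have sr : 0 <= sin r by apply: sin_ge0_pi; lra.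
rewrite -subr_ge0 -(pmulr_lge0 _ cu).
have -> : (r + tan u * cos r ^+ 2 - (u + sin r * cos r)) * cos u
        = cos r * (sin u * cos r - cos u * sin r) - (u - r) * cos u.
  by rewrite /tan; field; rewrite gt_eqF.
rewrite -sinB subr_ge0; case: (leP r u) => ru.
- have h0 : 0 <= u - r by lra.
  have hs : (u - r) * cos (u - r) <= sin (u - r) by apply: id_cos_le_sin; lra.
  have sh : 0 <= sin (u - r) by apply: sin_ge0_pi; lra.
  have cE : cos u = cos (u - r) * cos r - sin (u - r) * sin r.
    by rewrite -cosD subrK.
  have := ler_wpM2l cr hs; apply: le_trans.
  rewrite mulrCA ler_wpM2l// cE; nra.
- have hs : sin (r - u) <= r - u by apply: sin_le_id; lra.
  have hs0 : 0 <= sin (r - u) by apply: sin_ge0_pi; lra.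
  have cru : cos r <= cos u.
    by rewrite leNgt ltr_cos ?in_itv /=; [rewrite -leNgt; lra|lra|lra].
  rewrite -(opprB r u) sinN mulNr mulrN lerN2 mulrC.
  by apply: ler_pM.
Qed.

(* [r - sin r * cos r] is twice the area of a circular segment; the quadratic
   error disappears when the angle is subdivided. *)
Lemma segment_area_step p q : 0 <= p -> p <= q -> q <= pi / 2 ->
  (q - sin q * cos q) - (p - sin p * cos p) <=
  2 * sin p * (cos p - cos q) + 2 * (q - p) ^+ 2.
Proof.
move=> p0 pq qpi.
pose f z := 2 * sin p * (cos p - cos z) + 2 * (z - p) ^+ 2 - (z - sin z * cos z).
pose f' z := 2 * sin z * (sin p - sin z) + 4 * (z - p).
have : f p <= f q.
  apply: (@nondecreasing_of_deriv _ f') => //.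
  - move=> z; rewrite /f; apply: is_derive_eq.
    rewrite /GRing.scale /= /f'; have := cos2Dsin2 z => /(canRL (addrK _)) h.
    transitivity (2 * sin p * sin z + 4 * (z - p) - 1 - sin z ^+2 + cos z ^+ 2);
      last by rewrite h; ring.
    ring.
  - move=> z /andP[pz zq]; rewrite /f'.
    have := @sin_lipschitz p z (ltW pz); rewrite ler_norml => /andP[_ h].
    have s0 : 0 <= sin z by apply: sin_ge0_pi; have := pi_gt0 R; lra.
    have s1 := sin_le1 z.
    nra.
by rewrite /f; lra.
Qed.

(** With [tan y = tan x / 2], the subtraction formula gives [tan (x - y) = sin x * cos x / (1 + cos
    x ^+ 2)], which is smooth and never infinite. Subtracting its arctangent from [x] defines the
    continuous branch globally, with no case distinction at odd multiples of [pi / 2]. *)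
Definition half_phase x := x - atan (sin x * cos x / (1 + cos x ^+ 2)).

(** Clearing denominators in [tan (half_phase x) = tan x / 2] keeps the identity valid where
    [cos x = 0], as the secular equation of the tadpole requires. *)
Lemma half_phaseE x :
  2 * sin (half_phase x) * cos x = cos (half_phase x) * sin x.
Proof.
rewrite /half_phase; set A := atan _.
have cA : 0 < cos A.
  by apply: cos_gt0_pihalf; rewrite atan_gtNpi2 atan_ltpi2.
have : tan A = sin x * cos x / (1 + cos x ^+ 2) by rewrite atanK.
have D0 : 0 < 1 + cos x ^+ 2 by rewrite ltr_pwDl// sqr_ge0.
rewrite /tan => /eqP; rewrite eqr_div ?lt0r_neq0// => /eqP h.
rewrite sinB cosB.
have e := cos2Dsin2 x.
apply/eqP; rewrite -subr_eq0; apply/eqP.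
have -> : 2 * (sin x * cos A - cos x * sin A) * cos x
  - (cos x * cos A + sin x * sin A) * sin x
  = sin x * cos x * cos A
    - sin A * (cos x ^+ 2 + sin x ^+ 2 + cos x ^+ 2) by ring.
by rewrite e h subrr.
Qed.

Lemma is_derive_half_phase x :
  is_derive x 1 half_phase (2 / (1 + 3 * cos x ^+ 2)).
Proof.
have D0 : 1 + cos x ^+ 2 != 0 by rewrite lt0r_neq0// ltr_pwDl// sqr_ge0.
have dV : is_derive x 1 (fun z => (1 + cos z ^+ 2)^-1)
  (- (1 + cos x ^+ 2) ^- 2 *: (- (2 * cos x * sin x))).
  apply: is_deriveV => //.
  apply: is_derive_eq; rewrite /GRing.scale /=; ring.
have dN : is_derive x 1 (fun z => sin z * cos z / (1 + cos z ^+ 2))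
  ((3 * cos x ^+ 2 - 1) / (1 + cos x ^+ 2) ^+ 2).
  apply: is_derive_eq; rewrite /GRing.scale /=.
  have := cos2Dsin2 x => /(canRL (addKr _)) e.
  transitivity ((2 * cos x ^+ 2 * sin x ^+ 2
    - (1 + cos x ^+ 2) * sin x ^+ 2 + (1 + cos x ^+ 2) * cos x ^+ 2) /
    (1 + cos x ^+ 2) ^+ 2); first by field.
  by congr (_ / _); rewrite e; ring.
have dA := is_derive1_comp (is_derive1_atan _) dN.
rewrite /half_phase; apply: is_derive_eq.
have := cos2Dsin2 x => /(canRL (addKr _)) e.
set N := sin x * cos x; have N2 : N ^+ 2 = cos x ^+ 2 * (1 - cos x ^+ 2).
  by rewrite /N exprMn e; ring.
rewrite -[N / _]/(N * _) exprMn N2.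
have : 0 <= cos x ^+ 2 by exact: sqr_ge0.
move: (cos x ^+ 2) D0 => c D0 c0.
by field; rewrite D0 andbT; apply: lt0r_neq0; lra.
Qed.

Lemma half_phase0 : half_phase 0 = 0 :> R.
Proof. by rewrite /half_phase sin0 !mul0r atan0 subr0. Qed.

Lemma half_phase_pihalf : half_phase (pi / 2) = pi / 2 :> R.
Proof. by rewrite /half_phase cos_pihalf mulr0 mul0r atan0 subr0. Qed.

Lemma half_phaseB x : half_phase (pi - x) = pi - half_phase x.
Proof.
rewrite /half_phase sinB cosB sinpi cospi !mul0r add0r addr0.
rewrite !mulN1r opprK sqrrN mulrN mulNr atanN; ring.
Qed.

Lemma half_phase_pi : half_phase pi = pi :> R.
Proof. by rewrite -[pi in LHS]subr0 half_phaseB half_phase0 subr0. Qed.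

(** The derivative [2 / (1 + 3 * cos z ^+ 2)] is at least [1 / 2], since [cos z ^+ 2 <= 1]. One half
    is also the rate at which mass on doubly covered levels enters the phase, so no phase is lost
    when mass moves from the doubled band to a pendant edge. *)
Lemma ler_half_phase x y : x <= y -> (y - x) / 2 <= half_phase y - half_phase x.
Proof.
move=> xy.
suff : half_phase x - x / 2 <= half_phase y - y / 2 by lra.
apply: (@nondecreasing_of_deriv (fun z => half_phase z - z / 2)
  (fun z => 2 / (1 + 3 * cos z ^+ 2) - 2^-1) x y _ _ xy).
- move=> z; have := is_derive_half_phase z => h; apply: is_derive_eq.
  by rewrite /GRing.scale /= !mulr0 add0r mulr1.
- move=> z _; rewrite subr_ge0 ler_pdivlMr; last first.
    by rewrite ltr_pwDl// mulr_ge0 ?sqr_ge0.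
  have := sqr_ge0 (sin z); have := cos2Dsin2 z; nra.
Qed.

Lemma half_phase_superadditive x y : 0 <= x -> 0 <= y -> x + y <= pi ->
  half_phase x + half_phase y <= half_phase (x + y).
Proof.
(* The defect vanishes at [x = 0] and is symmetric about [x = (pi - y) / 2],
   so it is enough to treat the half where it is increasing. *)
wlog xy : x / 2 * x + y <= pi => [wl|] x0 y0 xypi.
  case: (leP (2 * x + y) pi) => [|/ltW] h; first exact: wl.
  have := wl (pi - y - x); rewrite (_ : pi - y - x + y = pi - x); last by ring.
  rewrite !half_phaseB (_ : pi - y - x = pi - (x + y)); last by ring.
  rewrite half_phaseB => /(_ ltac:(lra) ltac:(lra) ltac:(lra) ltac:(lra)); lra.
have : half_phase (0 + y) - half_phase 0 <= half_phase (x + y) - half_phase x.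
  apply: (@nondecreasing_of_deriv (fun z => half_phase (z + y) - half_phase z)
   (fun z => 2 / (1 + 3 * cos (z + y) ^+ 2) - 2 / (1 + 3 * cos z ^+ 2)) 0 x _ _ x0).
  - move=> z; have h' := is_derive_half_phase z.
    have h : is_derive z 1 (half_phase \o (fun z => z + y))
        (2 / (1 + 3 * cos (z + y) ^+ 2) * (1 + 0)).
      exact: is_derive1_comp (is_derive_half_phase _) _.
    apply: is_derive_eq.
    by rewrite addr0 mulr1.
  - move=> z /andP[z0 zx]; rewrite subr_ge0 ler_pM2l//.
    have P (t : R) : 0 < 1 + 3 * cos t ^+ 2 by have := sqr_ge0 (cos t); lra.
    rewrite lef_pV2 ?posrE//.
    rewrite lerD2l ler_pM2l//.
    (* The derivative of the defect has the sign of [cos z ^+ 2 - cos (z + y) ^+ 2], which this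
       identity makes a product of two nonnegative sines, as [2 * z + y <= pi]. *)
    have -> : cos (z + y) ^+ 2 = cos z ^+ 2 - sin (2 * z + y) * sin y.
      rewrite (_ : 2 * z + y = (z + y) + z) ; last by ring.
      have -> : sin y = sin ((z + y) - z) by congr sin; ring.
      have := cos2Dsin2 (z + y); have := cos2Dsin2 z.
      rewrite (sinD (z+y) z) sinB.
      move: (cos z) (sin z) (cos (z+y)) (sin (z+y)) => c s c' s' e e'.
      have -> : (s' * c + c' * s) * (s' * c - c' * s) = (c' ^+ 2 +
        s' ^+2) * c^+2 - c'^+2 * (c ^+ 2 + s ^+ 2) by ring.
      rewrite e e'; ring.
    rewrite gerBl mulr_ge0// sin_ge0_pi//; lra.
rewrite add0r half_phase0; lra.
Qed.

Lemma continuous_half_phase : continuous (@half_phase).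
Proof.
move=> x; have [h _] := is_derive_half_phase x.
by apply: differentiable_continuous; apply/derivable1_diffP.
Qed.

Lemma ltr_half_phase x y : x < y -> half_phase x < half_phase y.
Proof. by move=> xy; have := ler_half_phase (ltW xy); lra. Qed.

Lemma half_phase_ge0 x : 0 <= x -> 0 <= half_phase x.
Proof. by move=> x0; have := ler_half_phase x0; rewrite half_phase0; lra. Qed.

Lemma tan_half_phase x : 0 <= x < pi / 2 -> tan (half_phase x) = tan x / 2.
Proof.
move=> /andP[x0 xpi]; have E0 := half_phase_ge0 x0.
have Epi := ltr_half_phase xpi; rewrite half_phase_pihalf in Epi.
have cE : cos (half_phase x) != 0.
  by apply/lt0r_neq0/cos_gt0_pihalf; have := pi_gt0 R; lra.
have cx : cos x != 0.
  by apply/lt0r_neq0/cos_gt0_pihalf; have := pi_gt0 R; lra.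
transitivity (2 * sin (half_phase x) * cos x / (2 * cos (half_phase x) * cos x)).
  by rewrite /tan; field; rewrite ?cE ?cx.
by rewrite half_phaseE /tan; field; rewrite ?cE ?cx.
Qed.

(** Doubling the tangent inverts [half_phase] on [[0, pi / 2)]. Passing down from doubled to single
    levels doubles the tangent of the phase, passing down from single to doubled levels halves it,
    because multiplicity times tangent is preserved. *)
Lemma half_phase_atan x : 0 <= x < pi / 2 -> half_phase (atan (2 * tan x)) = x.
Proof.
move=> /andP[x0 xpi]; have pi0 := pi_gt0 R.
have t0 : 0 <= 2 * tan x.
  rewrite mulr_ge0 //.
  move: x0; rewrite le_eqVlt => /predU1P[<-|x0]; first by rewrite tan0.
  by rewrite ltW// divr_gt0// ?sin_gt0_pihalf ?x0// cos_gt0_pihalf//; lra.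
have a0 : 0 <= atan (2 * tan x) by rewrite -atan0; exact: le_atan.
have api := atan_ltpi2 (2 * tan x).
have E0 := half_phase_ge0 a0.
have Epi := ltr_half_phase api; rewrite half_phase_pihalf in Epi.
apply: tan_inj; rewrite ?in_itv /=; [lra|lra|].
by rewrite tan_half_phase ?a0// atanK; field.
Qed.

Lemma half_phase_root_exists a b : 0 <= a -> 0 <= b -> 0 < a + b ->
  exists2 k : R, 0 < k & half_phase (k * a) + k * b / 2 = pi.
Proof.
move=> a0 b0 ab0; have pi0 := pi_gt0 R.
pose f k := half_phase (k * a) + k * b / 2.
have cf : continuous f.
  have c1 : continuous (half_phase \o ( *%R^~ a)).
    move=> k; apply: continuous_comp; first exact: mulrr_continuous.
    exact: continuous_half_phase.
  move=> k; apply: cvgD; first exact: c1.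
  by apply: cvgMl; exact: mulrr_continuous.
(* The slope bound makes [f K] at least [K * (a + b) / 2], which is [pi] for this [K]. *)
pose K := 2 * pi / (a + b).
have K0 : 0 <= K by rewrite divr_ge0 ?ltW// mulr_gt0.
have f0 : f 0 = 0 by rewrite /f !mul0r half_phase0 addr0.
have fK : pi <= f K.
  have : 0 <= K * a by rewrite mulr_ge0.
  move=> /ler_half_phase; rewrite half_phase0 !subr0.
  have : K * a / 2 + K * b / 2 = pi by rewrite /K; field; rewrite gt_eqF.
  by rewrite /f; lra.
have [|k] := @IVT _ f 0 K pi K0 (continuous_subspaceT cf).
  by rewrite f0 ge_min le_max fK (ltW pi0) orbT.
rewrite in_itv /= => /andP[k0 _] fk; exists k => //.
rewrite lt_neqAle k0 andbT; apply/eqP => k00.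
by move: fk; rewrite -k00 f0 => p0; rewrite -p0 ltxx in pi0.
Qed.
End Trigo.

(** * Absolutely continuous functions on an interval *)
Section Rintegral_extra.
Context d (T : measurableType d) {R : realType}.
Variable mu : {measure set T -> \bar R}.
Implicit Types (A B D : set T) (f : T -> R).

Lemma ge0_subset_Rintegral A B f : measurable A -> measurable B -> A `<=` B ->
  mu.-integrable B (EFin \o f) -> (forall x, B x -> 0 <= f x) ->
  \int[mu]_(x in A) f x <= \int[mu]_(x in B) f x.
Proof.
move=> mA mB AB intf f0; have mBA : measurable (B `\` A) by exact: measurableD.
rewrite -[B in leRHS](setDUK AB) Rintegral_setU//.
- by rewrite lerDl Rintegral_ge0// => x [Bx _]; exact: f0.
- by rewrite setDUK.
- by apply/disj_setPS => x [? []].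
Qed.
End Rintegral_extra.

Definition clamp {R : realDomainType} (x y z : R) : R := Num.max x (Num.min y z).

Section Clamp.
Context {R : realDomainType}.
Implicit Types x y z : R.

Lemma clampN x y z : x <= y -> clamp (- y) (- x) (- z) = - clamp x y z.
Proof.
move=> xy; rewrite /clamp -oppr_max -oppr_min.
by rewrite !maxEle !minEle; case: ifP; case: ifP; case: ifP; case: ifP; lra.
Qed.
End Clamp.

Section H1.
Context {R : realType}.
Notation mu := (@lebesgue_measure R).
Implicit Types (f : R -> R) (l a b x y : R).

(** On a bounded interval square integrability gives integrability through [|f'| <= 1 + f' ^+ 2]. *)
Lemma H1_integrable l f (f' : R -> R) : H1_interval l f f' ->
  mu.-integrable `[0, l] (EFin \o f').
Proof.
move=> [mf' if'2 _].
have i1 : mu.-integrable `[0, l] (EFin \o (fun t : R => 1 + f' t ^+ 2)).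
  rewrite (_ : _ \o _ = (EFin \o cst 1) \+ (fun t => (f' t ^+ 2)%:E)); last first.
    by apply/funext => t /=; rewrite EFinD.
  apply: integrableD => //=.
  apply: continuous_compact_integrable; first exact: segment_compact.
  by apply: continuous_subspaceT => ?; exact: cvg_cst.
apply: le_integrable i1 => //=; first exact/measurable_EFinP.
move=> t _; rewrite lee_fin [leRHS]ger0_norm; last by rewrite addr_ge0 ?sqr_ge0.
by rewrite -[f' t ^+ 2]real_normK ?num_real//; have := normr_ge0 (f' t); nra.
Qed.

Lemma H1_increment l f (f' : R -> R) a b : H1_interval l f f' -> 0 <= a -> a <=
  b -> b <= l ->
  f b - f a = \int[mu]_(t in `]a, b[) f' t.
Proof.
move=> Hf a0 ab bl; have := H1_integrable Hf => i'; case: Hf => _ _ fE.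
rewrite (fE b) ?(fE a) ?in_itv /= ?a0 ?bl ?(le_trans a0)// ?(le_trans ab)//.
have i'b : mu.-integrable `[0, b] (EFin \o f').
  by apply: integrableS i' => //; apply: subset_itvl; rewrite bnd_simp.
rewrite opprD addrACA subrr add0r Rintegral_itvB//.
rewrite Rintegral_itv_bndo_bndc//.
apply: integrableS i'b => //; apply: subset_itv; rewrite bnd_simp//.
Qed.

Lemma H1_continuous l f (f' : R -> R) : 0 <= l -> H1_interval l f f' ->
  {within `[0, l], continuous f}.
Proof.
move=> l0 Hf; have i' := H1_integrable Hf; case: Hf => _ _ fE.
apply: (@subspace_eq_continuous _ _ _ (fun x => f 0 +
  \int[mu]_(t in `[0, x]) f' t)).
  by move=> x xl; rewrite /from_subspace [RHS]fE//; rewrite inE in xl.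
move=> x; apply: cvgD; first exact: cvg_cst.
by apply: parameterized_integral_continuous.
Qed.

Lemma within_level_compact f (C : set R) a b : {within `[a, b], continuous f} ->
  closed C -> compact (`[a, b] `&` f @^-1` C).
Proof.
move=> /continuous_closedP cf cC.
have [V cV VE] := (closed_subspaceP _ _).1 (cf _ cC).
by rewrite setIC -VE setIC; apply: compact_closedI => //; exact: segment_compact.
Qed.

(** [alpha] is the last point of [[a, b]] with [f <= s], and [beta] the first point of [[alpha, b]]
    with [f >= t]. *)
Lemma crossing_subinterval f a b s t : a <= b -> {within `[a, b], continuous f} ->
  f a <= s -> s < t -> t <= f b ->
  exists alpha beta, [/\ a <= alpha, alpha <= beta, beta <= b,
     f alpha <= s /\ t <= f beta &
     forall z, alpha < z < beta -> s < f z < t].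
Proof.
move=> ab cf fas st tfb.
have cid A : {within A, continuous (@id R)}.
  by apply: continuous_subspaceT => x; exact: cvg_id.
have [|alpha] := compact_EVT_max _ (within_level_compact cf (@closed_le R s)) (cid _).
  by exists a; split => //=; rewrite in_itv /= lexx.
rewrite inE /= in_itv /= => -[/andP[aa ab'] fal] amax.
have cf' : {within `[alpha, b], continuous f}.
  by apply: continuous_subspaceW cf; apply: subset_itvr; rewrite bnd_simp.
have [|beta] := compact_EVT_min _ (within_level_compact cf' (@closed_ge R t)) (cid _).
  by exists b; split => //=; rewrite in_itv /= lexx ab'.
rewrite inE /= in_itv /= => -[/andP[ab1 bb] fbe] bmin.
exists alpha, beta; split => // z /andP[az zb]; apply/andP; split.
- rewrite ltNge; apply/negP => fz.
  suff : z <= alpha by rewrite leNgt az.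
  apply: amax; rewrite inE /=; split => //; rewrite in_itv /=.
  by rewrite (le_trans aa (ltW az)) (le_trans (ltW zb)).
- rewrite ltNge; apply/negP => fz.
  suff : beta <= z by rewrite leNgt zb.
  apply: bmin; rewrite inE /=; split => //; rewrite in_itv /=.
  by rewrite (ltW az) (le_trans (ltW zb)).
Qed.

Lemma H1_measurable l f (f' : R -> R) : 0 <= l -> H1_interval l f f' ->
  measurable_fun `[0, l] f.
Proof.
move=> l0 /(H1_continuous l0) cf.
exact: subspace_continuous_measurable_fun.
Qed.

Lemma H1_opp l f (f' : R -> R) : H1_interval l f f' -> H1_interval l (\- f) (\- f').
Proof.
move=> Hf; have i' := H1_integrable Hf; case: Hf => mf' i2 fE; split.
- exact: measurableT_comp.
- by apply: eq_integrable i2 => // t _; rewrite /= sqrrN.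
- move=> x xl /=; rewrite (fE x xl) opprD; congr (_ + _).
  rewrite -mulN1r -RintegralZl//; first by apply: eq_Rintegral => t _;
    rewrite mulN1r.
  apply: integrableS i' => //; apply: subset_itvl; rewrite bnd_simp.
  by move: xl; rewrite in_itv /= => /andP[].
Qed.

(** This lower bound for the variation inside a band of levels stands in for the coarea formula. The
    clamped increment is realised on a subinterval where [f] stays strictly inside the band, and
    there it is at most the integral of [f']. *)
Lemma H1_crossing l f (f' : R -> R) a b x y : H1_interval l f f' ->
  0 <= a -> a <= b -> b <= l -> x <= y ->
  `|clamp x y (f b) - clamp x y (f a)| <=
  \int[mu]_(t in `]a, b[ `&` f @^-1` `]x, y[) `|f' t|.
Proof.
(* Replacing [f] by [- f] reverses the order of the clamped values, so it is enough to treat an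
   upward crossing. *)
wlog : f f' x y / clamp x y (f a) <= clamp x y (f b) => [wl|Hab] Hf a0 ab bl xy.
  have [h|/ltW h] := leP (clamp x y (f a)) (clamp x y (f b)); first exact: wl.
  have := wl (\- f) (\- f') (- y) (- x).
  rewrite /= !clampN// lerN2 lerN2 -opprD normrN => /(_ h (H1_opp Hf) a0 ab bl xy).
  move=> /le_trans; apply.
  rewrite (_ : _ @^-1` `]- y, - x[ = f @^-1` `]x, y[); last first.
    by apply/seteqP; split => t /=; rewrite !in_itv /= !ltrN2 andbC.
  by under eq_Rintegral do rewrite /= normrN.
have i' := H1_integrable Hf.
have cf : {within `[a, b], continuous f}.
  apply: continuous_subspaceW (H1_continuous (le_trans a0 (le_trans ab bl)) Hf).
  by apply: subset_itv; rewrite bnd_simp.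
have mI : measurable (`]a, b[ `&` f @^-1` `]x, y[).
  have sab : `]a, b[ `<=` `[0, l] by apply: subset_itv; rewrite bnd_simp.
  apply: (measurable_funS _ sab (H1_measurable (le_trans a0 (le_trans ab bl)) Hf)) => //.
rewrite ger0_norm ?subr_ge0//; move: Hab; rewrite le_eqVlt => /predU1P[->|Hab].
  by rewrite subrr Rintegral_ge0.
set s := clamp x y (f a) in Hab *; set t := clamp x y (f b) in Hab *.
have xs : x <= s by rewrite /s /clamp le_max lexx.
have ty : t <= y by rewrite /t /clamp ge_max xy ge_min lexx.
have fas : f a <= s.
  rewrite leNgt; apply/negP; rewrite /s /clamp gt_max gt_min ltxx orbF.
  move=> /andP[_ yfa]; have : y <= s
    by rewrite /s /clamp le_max le_min lexx (ltW yfa) orbT.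
  by lra.
have tfb : t <= f b.
  rewrite leNgt; apply/negP; rewrite /t /clamp lt_max lt_min ltxx andbF orbF.
  move=> fbx; have : t <= x by rewrite /t /clamp ge_max lexx ge_min (ltW fbx) orbT.
  by lra.
have [alpha [beta [aal albe beb [fal fbe] fin]]] :=
  crossing_subinterval ab cf fas Hab tfb.
have sub : `]alpha, beta[ `<=` `]a, b[ `&` f @^-1` `]x, y[.
  move=> z; rewrite /= !in_itv /= => /[dup] /fin /andP[sf ft] /andP[alz zbe].
  by rewrite (le_lt_trans aal alz) (lt_le_trans zbe beb) (le_lt_trans xs sf) (lt_le_trans ft ty).
have iS (D : set R) : measurable D -> D `<=` `[0, l] ->
  mu.-integrable D (EFin \o f').
  by move=> mD sD; exact: integrableS i'.
have iSn (D : set R) : measurable D -> D `<=` `[0, l] ->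
    mu.-integrable D (EFin \o (fun t => `|f' t|)).
  by move=> mD sD; apply: integrable_norm; exact: iS.
have sabl : `]a, b[ `&` f @^-1` `]x, y[ `<=` `[0, l].
  by move=> z [] /=; rewrite !in_itv /= => /andP[az zb] _;
    rewrite (le_trans a0 (ltW az)) (le_trans (ltW zb)).
apply: (@le_trans _ _ (f beta - f alpha)); first by lra.
rewrite (H1_increment Hf); [|lra..].
apply: le_trans (ler_norm _) _; apply: le_trans.
  apply: le_normr_Rintegral => //; apply: iS => //.
  exact: subset_trans sabl.
by apply: ge0_subset_Rintegral => //; exact: iSn.
Qed.

End H1.

(** * Level sets on a graph *)
Section LevelIntegral.
Context {R : realType} (G : metric_graph R).
Notation mu := (@lebesgue_measure R).
Implicit Types (f F H : edge G -> R -> R) (J K : set R).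

Definition edge_integrable F :=
  forall e, mu.-integrable `[0, len e] (EFin \o F e).

Definition edge_level f J e := `[0, len e] `&` f e @^-1` J.

Definition level_integral f F J : R :=
  \sum_e \int[mu]_(t in edge_level f J e) F e t.

Lemma edge_integrable_cst (c : R) : edge_integrable (fun _ _ => c).
Proof.
move=> e; apply: continuous_compact_integrable; first exact: segment_compact.
by apply: continuous_subspaceT => ?; exact: cvg_cst.
Qed.

Lemma edge_integrableZ (c : R) F : edge_integrable F ->
  edge_integrable (fun e t => c * F e t).
Proof.
move=> iF e; have -> : EFin \o (fun t => c * F e t) = (fun t =>
  c%:E * (F e t)%:E)%E.
  by apply/funext => t; rewrite /= EFinM.
exact: integrableZl (iF e).
Qed.

Lemma edge_integrableD F H : edge_integrable F -> edge_integrable H ->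
  edge_integrable (fun e t => F e t + H e t).
Proof.
move=> iF iH e; have -> : EFin \o (fun t => F e t +
  H e t) = (EFin \o F e) \+ (EFin \o H e).
  by apply/funext => t; rewrite /= EFinD.
exact: integrableD (iF e) (iH e).
Qed.

Lemma graph_integralE f F : graph_integral F = level_integral f F setT.
Proof. by apply: eq_bigr => e _; rewrite /edge_level preimage_setT setIT. Qed.

Section H1.
Variables (f f' : edge G -> R -> R).
Hypothesis Hf : H1_graph f f'.

Lemma edge_continuous e : {within `[0, len e], continuous (f e)}.
Proof. by apply: (H1_continuous (ltW (len_gt0 e)) (Hf.1 e)). Qed.

Lemma measurable_edge_level J e : measurable J -> measurable (edge_level f J e).
Proof.
by move=> mJ; apply: (H1_measurable (ltW (len_gt0 e)) (Hf.1 e)).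
Qed.

Lemma edge_level_integrable J F e : measurable J -> edge_integrable F ->
  mu.-integrable (edge_level f J e) (EFin \o F e).
Proof.
move=> mJ iF; apply: integrableS (iF e) => //; last by move=> t [].
exact: measurable_edge_level.
Qed.

Lemma edge_integrable_deriv2 : edge_integrable (fun e t => f' e t ^+ 2).
Proof. by move=> e; have [_ ? _] := Hf.1 e. Qed.

Lemma edge_integrable_norm_deriv : edge_integrable (fun e t => `|f' e t|).
Proof. by move=> e; apply: integrable_norm; exact: H1_integrable (Hf.1 e). Qed.

Lemma edge_integrable_fun : edge_integrable f.
Proof.
move=> e; apply: continuous_compact_integrable (@edge_continuous e).
exact: segment_compact.
Qed.

Lemma edge_integrable_fun2 : edge_integrable (fun e t => f e t ^+ 2).
Proof.
move=> e; apply: continuous_compact_integrable; first exact: segment_compact.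
have cf := @edge_continuous e; move=> t.
rewrite (_ : (fun t => f e t ^+ 2) = (fun t => f e t * f e t)); last
  by apply/funext => z; rewrite expr2.
by apply: cvgM; exact: cf.
Qed.

Lemma level_integralU F J K : edge_integrable F -> measurable J -> measurable K ->
  J `&` K = set0 ->
  level_integral f F (J `|` K) = level_integral f F J + level_integral f F K.
Proof.
move=> iF mJ mK JK; rewrite /level_integral -big_split /=.
apply: eq_bigr => e _.
have -> : edge_level f (J `|` K) e = edge_level f J e `|` edge_level f K e.
  by rewrite /edge_level preimage_setU setIUr.
rewrite Rintegral_setU //.
- exact: measurable_edge_level.
- exact: measurable_edge_level.
- rewrite /edge_level -setIUr -preimage_setU.
  by apply: edge_level_integrable => //; exact: measurableU.
- apply/disj_setPS => t [[_ Jt] [_ Kt]].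
  by have : (J `&` K) (f e t); [split|rewrite JK].
Qed.

Lemma level_integralZ (c : R) F J : edge_integrable F -> measurable J ->
  level_integral f (fun e t => c * F e t) J = c * level_integral f F J.
Proof.
move=> iF mJ; rewrite /level_integral mulr_sumr; apply: eq_bigr => e _.
by rewrite RintegralZl//;
  [exact: measurable_edge_level|exact: edge_level_integrable].
Qed.

Lemma level_integralD F H J : edge_integrable F -> edge_integrable H ->
  measurable J ->
  level_integral f (fun e t => F e t + H e t) J =
  level_integral f F J + level_integral f H J.
Proof.
move=> iF iH mJ; rewrite /level_integral -big_split /=; apply: eq_bigr => e _.
by rewrite RintegralD//;
  [exact: measurable_edge_level|exact: edge_level_integrable..].
Qed.

Lemma ler_level_integral F H J : edge_integrable F -> edge_integrable H ->
  measurable J -> (forall e t, 0 <= t <= len e -> J (f e t) -> F e t <= H e t) ->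
  level_integral f F J <= level_integral f H J.
Proof.
move=> iF iH mJ FH; apply: ler_sum => e _; apply: le_Rintegral.
- exact: measurable_edge_level.
- exact: edge_level_integrable.
- exact: edge_level_integrable.
- by move=> t [/= te Jt]; apply: FH => //; rewrite in_itv /= in te.
Qed.

Lemma level_integral_subset F J K : edge_integrable F -> measurable J ->
  measurable K ->
  (forall e t, 0 <= F e t) -> J `<=` K ->
  level_integral f F J <= level_integral f F K.
Proof.
move=> iF mJ mK F0 JK; apply: ler_sum => e _; apply: ge0_subset_Rintegral.
- exact: measurable_edge_level.
- exact: measurable_edge_level.
- by move=> t [te Jt]; split => //; exact: JK.
- exact: edge_level_integrable.
- by [].
Qed.

Lemma level_integral_ge0 F J : (forall e t, 0 <= F e t) -> 0 <=
  level_integral f F J.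
Proof. by move=> F0; apply: sumr_ge0 => e _; apply: Rintegral_ge0. Qed.

Lemma level_integral_set0 F : level_integral f F set0 = 0.
Proof.
by apply: big1 => e _; rewrite /edge_level preimage_set0 setI0 Rintegral_set0.
Qed.
End H1.

(** For fixed [f], these quantities are additive in the set [J] of levels, [level_mass] being the
    image of the length measure under [f]. The estimate then takes place on the line of levels. *)
Definition level_mass f J := level_integral f (fun _ _ => 1) J.
Definition level_energy f (f' : edge G -> R -> R) J :=
  level_integral f (fun e t => f' e t ^+ 2) J.
Definition level_square f J := level_integral f (fun e t => f e t ^+ 2) J.
Definition level_variation f (f' : edge G -> R -> R) J :=
  level_integral f (fun e t => `|f' e t|) J.

(* [f] takes every level between [x] and [y] at least [n] times, expressed
   through the coarea formula. *)
Definition crosses f (f' : edge G -> R -> R) (n x y : R) :=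
  forall x' y', x <= x' -> x' < y' -> y' <= y ->
    n * (y' - x') <= level_variation f f' `]x', y'[.

Lemma Rintegral_edge_length (e : edge G) : \int[mu]_(t in `[0, len e]) (1 :
  R) = len e.
Proof.
have mE : mu `[0, len e] = (len e)%:E.
  by rewrite lebesgue_measure_itv /= lte_fin len_gt0 -EFinD subr0.
by rewrite Rintegral_cst// mul1r -[RHS]/(fine (len e)%:E); congr fine.
Qed.

Lemma level_mass_setT f : level_mass f setT = total_length G.
Proof.
rewrite /level_mass -graph_integralE; apply: eq_bigr => e _.
exact: Rintegral_edge_length.
Qed.

Section Profile.
Variables (f f' : edge G -> R -> R).
Hypothesis Hf : H1_graph f f'.

(** This is [(|f'| - w) ^+ 2 >= 0], integrated over the levels in [J] with a constant calibration
    [w]. *)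
Lemma level_energy_lower w J : measurable J ->
  2 * w * level_variation f f' J - w ^+ 2 * level_mass f J <= level_energy f f' J.
Proof.
move=> mJ.
have i1 := edge_integrableZ (2 * w) (edge_integrable_norm_deriv Hf).
have i2 := edge_integrableZ (- w ^+ 2) (@edge_integrable_cst 1).
rewrite -mulNr -(level_integralZ Hf _ (edge_integrable_norm_deriv Hf) mJ).
rewrite -(level_integralZ Hf _ (@edge_integrable_cst 1) mJ) -(level_integralD Hf)//.
apply: (ler_level_integral Hf) => //.
- exact: edge_integrableD.
- exact: edge_integrable_deriv2 Hf.
- move=> e t _ _; rewrite -[f' e t ^+ 2]real_normK ?num_real//.
  have := sqr_ge0 (`|f' e t| - w); nra.
Qed.

Lemma level_square_upper (y : R) J : measurable J -> (forall z, J z -> `|z| <= y) ->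
  level_square f J <= y ^+ 2 * level_mass f J.
Proof.
move=> mJ Jy; rewrite -(level_integralZ Hf _ (@edge_integrable_cst 1) mJ).
apply: (ler_level_integral Hf) => //.
- exact: edge_integrable_fun2 Hf.
- exact: edge_integrableZ (@edge_integrable_cst 1).
- move=> e t _ /Jy; rewrite -[f e t ^+ 2]real_normK ?num_real//.
  by have := normr_ge0 (f e t); nra.
Qed.

End Profile.
End LevelIntegral.

(** * Calibrated energy bound on a band of levels *)

(** Quadratic errors vanish under subdivision: with [N.+1] equal steps they add up to
    [K * (b - a) ^+ 2 / N.+1]. This replaces the integration of a calibration that varies with the
    level. *)
Lemma additive_interval_lower_bound (R : realType) (F : R -> R -> R)
    (g : R -> R) (K a b : R) : a <= b ->
  (forall p q s, a <= p -> p <= q -> q <= s -> s <= b -> F p s = F p q + F q s) ->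
  (forall p q, a <= p -> p <= q -> q <= b ->
     g q - g p <= F p q + K * (q - p) ^+ 2) ->
  g b - g a <= F a b.
Proof.
move=> ab Fadd Flow; rewrite leNgt; apply/negP => lt.
pose d := g b - g a - F a b; have d0 : 0 < d by rewrite subr_gt0.
(* A deficit [d] would be bounded by the total error for every number of steps, contrary to the
   Archimedean property. *)
have main N : d * N.+1%:R <= K * (b - a) ^+ 2.
  pose h := (b - a) / N.+1%:R; have N0 : 0 < N.+1%:R :> R by rewrite ltr0Sn.
  have h0 : 0 <= h by rewrite divr_ge0 ?subr_ge0// ltW.
  have ih i : (i <= N.+1)%N ->
      g (a + i%:R * h) - g a <= F a (a + i%:R * h) + i%:R * (K * h ^+ 2).
    elim: i => [_|i IH iN].
      rewrite !mul0r !addr0 subrr.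
      by have := Fadd a a a (lexx _) (lexx _) (lexx _) ab; lra.
    have i1b : a + i.+1%:R * h <= b.
      rewrite -lerBrDl /h mulrA ler_pdivrMr// mulrC ler_wpM2l ?subr_ge0//.
      by rewrite ler_nat.
    have ai : a <= a + i%:R * h by rewrite lerDl mulr_ge0.
    have ii1 : a + i%:R * h <= a + i.+1%:R * h.
      by rewrite lerD2l ler_wpM2r// ler_nat.
    have := IH (ltnW iN); rewrite (Fadd _ _ _ (lexx a) ai ii1 i1b).
    have := Flow _ _ ai ii1 i1b.
    rewrite (_ : a + i.+1%:R * h - (a + i%:R * h) = h); last first.
      by rewrite -natr1; ring.
    have -> : i.+1%:R * (K * h ^+ 2) = i%:R * (K * h ^+ 2) + K * h ^+ 2
      by rewrite -natr1; ring.
    lra.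
  have := ih _ (leqnn _).
  have -> : a + N.+1%:R * h = b by rewrite /h mulrC divfK ?gt_eqF// addrC subrK.
  have -> : N.+1%:R * (K * h ^+ 2) = K * (b - a) ^+ 2 / N.+1%:R.
    by rewrite /h; move: N0; move: (N.+1%:R : R) => m m0; field; rewrite gt_eqF.
  by rewrite -ler_pdivlMr// /d; move: (_ / N.+1%:R) => c; lra.
have := main (Num.bound (K * (b - a) ^+ 2 / d)).
rewrite mulrC -ler_pdivlMr// leNgt => /negP; apply.
apply: lt_trans (archi_boundP _) _; last by rewrite ltr_nat.
have := main 0%N; rewrite mulr1 => dK.
by rewrite divr_ge0 ?(le_trans _ dK) ?ltW.
Qed.

Section Chain.
Context {R : realType} (G : metric_graph R).
Variables (f f' : edge G -> R -> R).
Hypothesis Hf : H1_graph f f'.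
Implicit Types J K : set R.

(** For [J = setT], nonnegativity says that the energy is at least [k ^+ 2] times the integral of
    [f ^+ 2]. As the defect is additive in [J], it can be estimated band by band. *)
Definition level_defect (k : R) J :=
  level_energy f f' J - k ^+ 2 * level_square f J.

Lemma level_energy_ge0 J : 0 <= level_energy f f' J.
Proof. by apply: level_integral_ge0 => e t; exact: sqr_ge0. Qed.

Lemma level_mass_ge0 J : 0 <= level_mass f J.
Proof. exact: level_integral_ge0. Qed.

Lemma level_massU J K : measurable J -> measurable K -> J `&` K = set0 ->
  level_mass f (J `|` K) = level_mass f J + level_mass f K.
Proof. by apply: (level_integralU Hf); exact: edge_integrable_cst. Qed.

Lemma le_level_mass J K : measurable J -> measurable K -> J `<=` K ->
  level_mass f J <= level_mass f K.
Proof.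
by move=> ? ? ?; apply: (level_integral_subset Hf) => //;
  exact: edge_integrable_cst.
Qed.

Lemma level_defectU k J K : measurable J -> measurable K -> J `&` K = set0 ->
  level_defect k (J `|` K) = level_defect k J + level_defect k K.
Proof.
move=> mJ mK JK; rewrite /level_defect /level_energy /level_square.
rewrite !(level_integralU Hf)//; first by ring.
- exact: edge_integrable_fun2 Hf.
- exact: edge_integrable_deriv2 Hf.
Qed.

(** The calibration [w] is constant on one thin band, and [f ^+ 2] is bounded there by [y ^+ 2]. The
    coefficient of the mass is the same for all bands once [w ^+ 2 + k ^+ 2 * y ^+ 2] is kept
    constant. *)
Lemma level_defect_step k n w x y J : measurable J -> 0 <= w -> 0 <= x -> x < y ->
  `]x, y[ `<=` J -> (forall z, J z -> `|z| <= y) -> crosses f f' n x y ->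
  2 * n * w * (y - x) - (w ^+ 2 + k ^+ 2 * y ^+ 2) * level_mass f J <=
    level_defect k J.
Proof.
move=> mJ w0 x0 xy xyJ Jy cr; have mI : measurable (`]x, y[ : set R) by [].
have := cr _ _ (lexx x) xy (lexx y) => V.
have E1 := level_energy_lower Hf w mI.
have E2 : level_energy f f' `]x, y[ <= level_energy f f' J.
  apply: (level_integral_subset Hf) => //; last by move=> *; exact: sqr_ge0.
  exact: edge_integrable_deriv2 Hf.
have M := le_level_mass mI mJ xyJ.
have S := ler_wpM2l (sqr_ge0 k) (level_square_upper Hf mJ Jy).
have V' := ler_wpM2l w0 V.
have M' := ler_wpM2l (sqr_ge0 w) M.
by rewrite /level_defect; lra.
Qed.

(* The boundary terms are those of [y cos (k s + psi) / cos psi], whose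
   logarithmic derivative is [- k tan psi] at the level [y] and [- k tan u] where
   [s] has grown to [level_mass f J / n]. The calibration is
   [w = k sqrt (B ^ 2 - t ^ 2)] at the level [t], with [B = y / cos psi], written
   as [w = k B sin p] at [t = B cos p]. *)
Lemma level_defect_lower (k n x y psi : R) J : 0 < k -> 0 < n -> 0 <= x -> x <= y ->
  measurable J -> `]x, y[ `<=` J -> J `<=` `[x, y] -> crosses f f' n x y ->
  0 <= psi -> psi + k * level_mass f J / n < pi / 2 ->
  n * k * (tan psi * y ^+ 2 - tan (psi + k * level_mass f J / n) * x ^+ 2)
    <= level_defect k J.
Proof.
move=> k0 n0 x0 xy mJ xyJ Jxy cr psi0.
set u := psi + _ => upi; have pi0 := pi_gt0 R.
have M0 := level_mass_ge0 J.
have psiu : psi <= u by rewrite lerDl divr_ge0 ?mulr_ge0// ltW.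
have cpsi : 0 < cos psi by apply: cos_gt0_pihalf; lra.
have mI (a b : R) : measurable (`[a, b[ : set R) by [].
pose B := y / cos psi; have yB : y = B * cos psi by rewrite /B divfK ?gt_eqF.
have y0 := le_trans x0 xy.
(* For [y = 0] the amplitude [B] vanishes and no angles can be assigned; then [f] is 0 on the levels
   in [J], and the energy is nonnegative. *)
have [y_eq0|y_neq0] := eqVneq y 0.
  have -> : x = 0 by lra.
  rewrite y_eq0 expr0n !mulr0 subrr mulr0 /level_defect subr_ge0.
  apply: le_trans (level_energy_ge0 _); rewrite mulr_ge0_le0 ?sqr_ge0//.
  have := @level_square_upper _ _ _ _ Hf 0 J mJ; rewrite expr0n mul0r; apply.
  move=> z /Jxy /=; rewrite in_itv /= => /andP[xz zy].
  by rewrite normr_le0 eq_le; apply/andP; split; lra.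
have {y_neq0}y_gt0 : 0 < y by rewrite lt_neqAle eq_sym y_neq0.
have B0 : 0 < B by rewrite divr_gt0.
have yleB : y <= B by rewrite yB ler_piMr ?cos_le1// ltW.
have xB01 : 0 <= x / B <= 1.
  apply/andP; split; first exact: divr_ge0 x0 (ltW B0).
  by rewrite ler_pdivrMr// mul1r (le_trans xy).
(* [r] is the angle at which the calibration reaches the level [x], whereas [u] is the angle
   measured by the mass. They may differ, and [tangent_gap] compares them. *)
pose r := acos (x / B).
have xB : x = B * cos r.
  by rewrite /r acosK ?in_itv /=; [rewrite mulrC divfK ?gt_eqF|lra].
have r0 : 0 <= r by apply: acos_ge0; lra.
have rpi : r <= pi / 2.
  rewrite leNgt; apply/negP => h.
  have : cos r < cos (pi / 2).
    have rlepi : r <= pi by apply: acos_lepi; lra.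
    by rewrite ltr_cos ?in_itv /=; lra.
  rewrite cos_pihalf ltNge => /negP; apply.
  by rewrite -(pmulr_rge0 _ B0) -xB.
have cos_le (p q : R) : 0 <= p -> p <= q -> q <= pi / 2 -> cos q <= cos p.
  by move=> p0 pq qpi; rewrite leNgt ltr_cos ?in_itv /= -?leNgt//; lra.
have psir : psi <= r.
  rewrite leNgt; apply/negP => h; have : cos psi < cos r.
    by rewrite ltr_cos ?in_itv /=; lra.
  by rewrite -(ltr_pM2l B0) -xB -yB ltNge xy.
have nkB : 0 <= n * k * B ^+ 2.
  by apply: mulr_ge0 (sqr_ge0 _); apply: mulr_ge0 (ltW _) (ltW _).
have muE : k * level_mass f J = n * (u - psi) by rewrite /u; field; rewrite gt_eqF.
clearbody u r B.
(* Half-open bands make consecutive pieces disjoint; the top level [y] is left over and added at the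
   end. *)
pose I p q := J `&` `[B * cos q, B * cos p[.
have mIpq p q : measurable (I p q) by exact: measurableI.
pose F p q := level_defect k (I p q) + k ^+ 2 * B ^+ 2 * level_mass f (I p q).
(* The calibrated variation is the integral of [2 * n * w] over the levels [t]. With
   [w = k * B * sin p] and [t = B * cos p] it becomes that of [2 * n * k * B ^+ 2 * sin p ^+ 2] over
   [p], and [g] is a primitive. *)
pose g p := n * k * B ^+ 2 * (p - sin p * cos p).
have main : g r - g psi <= F psi r.
  apply: (@additive_interval_lower_bound _ F g (2 * n * k * B ^+ 2)) => //.
  - move=> p q s pp pq qs sr; rewrite /F.
    have c1 : B * cos q <= B * cos p by rewrite ler_wpM2l ?(ltW B0) ?cos_le//; lra.
    have c2 : B * cos s <= B * cos q by rewrite ler_wpM2l ?(ltW B0) ?cos_le//; lra.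
    have -> : I p s = I p q `|` I q s.
      rewrite /I -setIUr; congr (J `&` _); apply/seteqP; split => z /=;
        rewrite !in_itv /=.
        by move=> /andP[z1 z2]; have [h|h] := leP (B * cos q) z; [left|right]; lra.
      by move=> [|] /andP[z1 z2]; lra.
    have dis : I p q `&` I q s = set0.
      rewrite -subset0 => z [[_ /=]] ; rewrite !in_itv /= => /andP[z1 z2] [_ /=].
      by rewrite in_itv /= => /andP[z3 z4]; lra.
    by rewrite level_defectU// level_massU//; ring.
  - move=> p q pp pq qr.
    have p0 : 0 <= p by lra.
    have step := segment_area_step p0 pq (le_trans qr rpi).
    have step' := ler_wpM2l nkB step.
    have sp : 0 <= sin p by apply: sin_ge0_pi; lra.
    have : 2 * n * (k * B * sin p) * (B * cos p - B * cos q) <= F p q.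
      have cq : 0 <= cos q by apply: cos_ge0_pihalf; lra.
      have := cos_le p q p0 pq (le_trans qr rpi); rewrite le_eqVlt =>
        /predU1P[cqp|cqp].
        rewrite cqp subrr mulr0 /F (_ : I p q = set0).
          rewrite /level_defect /level_energy /level_square /level_mass.
          by rewrite !level_integral_set0 !mulr0 subrr addr0.
        by rewrite -subset0 => z [_ /=]; rewrite in_itv /= cqp => /andP[]; lra.
      have := @level_defect_step k n (k * B * sin p) (B * cos q) (B * cos p) (I p q) (mIpq p q).
      have -> : (k * B * sin p) ^+ 2 + k ^+ 2 * (B * cos p) ^+ 2 = k ^+ 2 * B ^+ 2.
        by rewrite -[RHS]mulr1 -(cos2Dsin2 p); ring.
      move=> H; rewrite /F -lerBlDr; apply: H.
      + exact: mulr_ge0 (mulr_ge0 (ltW k0) (ltW B0)) sp.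
      + exact: mulr_ge0 (ltW B0) cq.
      + by rewrite ltr_pM2l.
      + move=> z /=; rewrite in_itv /= => /andP[z1 z2]; split.
          apply: xyJ; rewrite /= in_itv /=; apply/andP; split.
            apply: le_lt_trans z1; rewrite xB ler_wpM2l ?(ltW B0)// cos_le//; lra.
          apply: lt_le_trans z2 _; rewrite yB ler_wpM2l ?(ltW B0)// cos_le//; lra.
        by rewrite /= in_itv /= z2 (ltW z1).
      + move=> z [_ /=]; rewrite in_itv /= => /andP[z1 /ltW z2].
        rewrite ger0_norm//; apply: le_trans z1; exact: mulr_ge0 (ltW B0) cq.
      + move=> x' y' x'q x'y' y'p; apply: cr => //.
          apply: le_trans x'q; rewrite xB ler_wpM2l ?(ltW B0)// cos_le//; lra.
        apply: le_trans y'p _; rewrite yB ler_wpM2l ?(ltW B0)// cos_le//; lra.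
    rewrite /g; lra.
have mK : measurable (J `&` `[y, y]) by exact: measurableI.
have JE : J = I psi r `|` (J `&` `[y, y]).
  rewrite /I -setIUr -xB -yB; apply/seteqP; split => [z Jz|z [] //]; split => //=.
  have := Jxy _ Jz; rewrite /= !in_itv /= => /andP[xz zy].
  by have [h|h] := ltP z y; [left|right]; rewrite ?xz ?h ?zy.
have dis : I psi r `&` (J `&` `[y, y]) = set0.
  rewrite -subset0 => z [[_ /=]]; rewrite -xB -yB !in_itv /= => /andP[_ z1] [_].
  by move=> /andP[z2 _]; lra.
have defE : level_defect k J = level_defect k (I psi r) +
  level_defect k (J `&` `[y, y]).
  by rewrite [in LHS]JE level_defectU.
have massE : level_mass f J = level_mass f (I psi r) + level_mass f (J `&` `[y, y]).
  by rewrite [in LHS]JE level_massU.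
have defK : - (k ^+ 2 * B ^+ 2 * level_mass f (J `&` `[y, y])) <=
  level_defect k (J `&` `[y, y]).
  have := level_energy_ge0 (J `&` `[y, y]).
  have : level_square f (J `&` `[y, y]) <= B ^+ 2 * level_mass f (J `&` `[y, y]).
    apply: (level_square_upper Hf mK) => z [_ /=]; rewrite in_itv /= =>
      /andP[z1 z2].
    by rewrite ger0_norm; lra.
  move=> /(ler_wpM2l (sqr_ge0 k)); rewrite /level_defect; lra.
have nkBE : k ^+ 2 * B ^+ 2 * level_mass f J = n * k * B ^+ 2 * (u - psi).
  transitivity (k * B ^+ 2 * (k * level_mass f J)); first by ring.
  by rewrite muE; ring.
have gap : u + sin r * cos r <= r + tan u * cos r ^+ 2.
  by apply: tangent_gap; [rewrite r0|lra].
have := ler_wpM2l nkB gap.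
have -> : n * k * (tan psi * y ^+ 2 - tan u * x ^+ 2)
  = n * k * B ^+ 2 * (sin psi * cos psi) - n * k * B ^+ 2 * (tan u * cos r ^+ 2).
  by rewrite {1}yB {1}xB /(tan psi); field; rewrite gt_eqF.
move: main defE defK nkBE; rewrite {1}massE /F /g.
move: (n * k * B ^+ 2) (k ^+ 2 * B ^+ 2) => N M; lra.
Qed.
End Chain.

(** * Translation and reflection of the function *)

Section Transport.
Context {R : realType} (G : metric_graph R).
Implicit Types (f g F : edge G -> R -> R) (J K : set R).

Lemma eq_level_integral f g F J K :
  (forall e t, 0 <= t <= len e -> J (f e t) <-> K (g e t)) ->
  level_integral f F J = level_integral g F K.
Proof.
move=> JK; apply: eq_bigr => e _; congr (Rintegral _ _ _).
by apply/seteqP; split => t [te ft]; split => //; apply/JK => //;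
  move: te; rewrite /= in_itv.
Qed.

Definition graph_shift f (c : R) e t := f e t - c.
Definition graph_opp f e t := - f e t.

Lemma H1_graph_shift f (f' : edge G -> R -> R) c :
  H1_graph f f' -> H1_graph (graph_shift f c) f'.
Proof.
move=> [Hf [u Hu]]; split.
  by move=> e; have [? ? fE] := Hf e; split => // x xl;
    rewrite /graph_shift fE//; ring.
by exists (fun v => u v - c) => e; have [h0 hl] := Hu e; rewrite /graph_shift h0 hl.
Qed.

Lemma H1_graph_opp f (f' : edge G -> R -> R) :
  H1_graph f f' -> H1_graph (graph_opp f) (graph_opp f').
Proof.
move=> [Hf [u Hu]]; split; first by move=> e; exact: H1_opp (Hf e).
by exists (fun v => - u v) => e; have [h0 hl] := Hu e; rewrite /graph_opp h0 hl.
Qed.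

Lemma crosses_subset f (f' : edge G -> R -> R) (n x y a b : R) :
  crosses f f' n x y -> x <= a -> b <= y -> crosses f f' n a b.
Proof.
move=> cr xa yb x' y' ax xy' y'b; apply: cr => //.
- exact: le_trans ax.
- exact: le_trans yb.
Qed.

Lemma crosses_shift f (f' : edge G -> R -> R) (n x y c : R) :
  crosses f f' n x y -> crosses (graph_shift f c) f' n (x - c) (y - c).
Proof.
move=> cr x' y' xx xy' yy.
have := cr (x' + c) (y' + c); rewrite (_ : y' + c - (x' + c) = y' - x'); last
  by ring.
move=> /(_ ltac:(lra) ltac:(lra) ltac:(lra)) /le_trans; apply.
rewrite le_eqVlt; apply/orP; left; apply/eqP; apply: eq_level_integral => e t _.
by rewrite /= !in_itv /= /graph_shift ltrBrDr ltrBlDr.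
Qed.

Lemma crosses_opp f (f' : edge G -> R -> R) (n x y : R) :
  crosses f f' n x y -> crosses (graph_opp f) (graph_opp f') n (- y) (- x).
Proof.
move=> cr x' y' xx xy' yy.
have := cr (- y') (- x'); rewrite (_ : - x' - - y' = y' - x'); last by ring.
move=> /(_ ltac:(lra) ltac:(lra) ltac:(lra)) /le_trans; apply.
rewrite le_eqVlt; apply/orP; left; apply/eqP.
transitivity (level_integral (graph_opp f) (fun e t => `|f' e t|) `]x', y'[).
  apply: eq_level_integral => e t _.
  by rewrite /= !in_itv /= /graph_opp ltrNl ltrNr andbC.
by apply: eq_bigr => e _; apply: eq_Rintegral => t _; rewrite /graph_opp normrN.
Qed.

Lemma level_mass_opp f J K :
  (forall z, J z <-> K (- z)) -> level_mass (graph_opp f) J = level_mass f K.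
Proof.
by move=> JK; apply: eq_level_integral => e t _; rewrite JK /graph_opp opprK.
Qed.
End Transport.

(** * Nonnegative defect above the zero level *)

Section Half.
Context {R : realType} (G : metric_graph R).
Implicit Types (f : edge G -> R -> R) (J K : set R).

(** The calibration runs downwards from the top level [A], where the phase starts at 0, through
    single, doubled and again single levels. Multiplicity times tangent agrees at [M] and at [m], so
    the boundary terms telescope; the last one is multiplied by the square of the level 0. *)
Lemma level_defect_pos_ge0 f (f' : edge G -> R -> R) (k m M A : R) :
  H1_graph f f' -> 0 < k -> 0 <= m -> m <= M -> M <= A ->
  (forall e t, 0 <= t <= len e -> f e t <= A) ->
  crosses f f' 1 0 m -> crosses f f' 2 m M -> crosses f f' 1 M A ->
  let phi := half_phase (k * level_mass f `]M, +oo[)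
     + k * level_mass f (`[m, M] `&` `]0, +oo[) / 2 in
  k * level_mass f `]M, +oo[ < pi / 2 -> phi < pi / 2 ->
  atan (2 * tan phi) + k * level_mass f `]0, m[ < pi / 2 ->
  0 <= level_defect f f' k `]0, +oo[.
Proof.
move=> Hf k0 m0 mM MA fA c1 c2 c3 phi h3 h2 h1.
have pi0 := pi_gt0 R.
pose J1 := `]0, m[%classic; pose J2 := `[m, M]%classic `&` `]0, +oo[.
(* The calibration needs a bounded band; above [A] there is nothing to integrate. *)
pose J3 := `]M, +oo[%classic; pose J3' := `]M, A]%classic.
have E3 F : level_integral f F J3 = level_integral f F J3'.
  apply: eq_level_integral => e t te; rewrite /J3 /J3' /= !in_itv /= andbT fA//.
  by rewrite andbT.
have mJ1 : measurable J1 by exact: measurable_itv.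
have mJ2 : measurable J2 by apply: measurableI; exact: measurable_itv.
have mJ3 : measurable J3 by exact: measurable_itv.
have mJ3' : measurable J3' by exact: measurable_itv.
have b0 : 0 <= k * level_mass f J3 by rewrite mulr_ge0 ?(ltW k0)// level_mass_ge0.
have phi0 : 0 <= phi.
  rewrite addr_ge0 ?half_phase_ge0//.
  by rewrite divr_ge0// mulr_ge0 ?(ltW k0)// level_mass_ge0.
have d3 : 1 * k * (tan 0 * A ^+ 2 - tan (0 + k * level_mass f J3' / 1) * M ^+ 2)
    <= level_defect f f' k J3'.
  apply: (level_defect_lower Hf k0 ltr01 (le_trans m0 mM) MA mJ3' _ _ c3) => //.
  - by move=> z; rewrite /J3' /= !in_itv /= => /andP[-> /ltW].
  - by move=> z; rewrite /J3' /= !in_itv /= => /andP[/ltW -> ->].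
  - by rewrite add0r divr1 /level_mass -E3.
have d2 : 2 * k * (tan (half_phase (k * level_mass f J3)) * M ^+ 2
     - tan phi * m ^+ 2) <= level_defect f f' k J2.
  apply: (level_defect_lower Hf k0 (ltr0n _ 2) m0 mM mJ2 _ _ c2) => //.
  - move=> z; rewrite /J2 /= !in_itv /= => /andP[mz zM].
    by rewrite (ltW mz) (ltW zM) (le_lt_trans m0 mz).
  - by move=> z [].
  - exact: half_phase_ge0.
have a0 : 0 <= atan (2 * tan phi).
  have := half_phase_atan (_ : 0 <= phi < pi / 2); rewrite phi0 h2 => /(_ isT) E.
  rewrite leNgt; apply/negP => /ltr_half_phase; rewrite E half_phase0.
  by rewrite ltNge phi0.
have d1 : 1 * k * (tan (atan (2 * tan phi)) * m ^+ 2
   - tan (atan (2 * tan phi) + k * level_mass f J1 / 1) * 0 ^+ 2)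
    <= level_defect f f' k J1.
  apply: (level_defect_lower Hf k0 ltr01 (lexx 0) m0 mJ1 _ _ c1) => //.
  - exact: subset_itv_oo_cc.
  - by rewrite divr1.
have D : level_defect f f' k `]0, +oo[ =
    level_defect f f' k J1 + (level_defect f f' k J2 + level_defect f f' k J3).
  rewrite -!(level_defectU Hf)//; [congr level_defect|exact: measurableU|..].
  - apply/seteqP; split => z; rewrite /J1 /J2 /J3 /= !in_itv /= !andbT.
      move=> z0; have [zm|mz] := ltP z m; first by left; rewrite z0.
      by right; have [zM|Mz] := leP z M; [left|right].
    by move=> [/andP[]//|[[]//|]]; lra.
  - rewrite -subset0 => z; rewrite /J1 /J2 /J3 /= !in_itv /= !andbT =>
    -[/andP[z1 z2]].
    by move=> [[/andP[z3 z4] _]|z3]; lra.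
  - rewrite -subset0 => z; rewrite /J2 /J3 /= !in_itv /= !andbT =>
    -[[/andP[z1 z2] _]].
    by lra.
have D3 : level_defect f f' k J3 = level_defect f f' k J3'.
  by rewrite /level_defect /level_energy /level_square !E3.
rewrite D D3; move: d3 d2 d1; rewrite tan0 add0r divr1 atanK expr0n /=.
rewrite tan_half_phase ?b0 ?h3// /level_mass -E3 -/(level_mass f J3).
lra.
Qed.
End Half.

(** * Quantile levels *)

Section Quantile.
Context {R : realType} (G : metric_graph R).
Notation mu := (@lebesgue_measure R).
Variables (f f' : edge G -> R -> R).
Hypothesis Hf : H1_graph f f'.

(** The sets where [f < c - n.+1%:R^-1] increase to the set where [f < c], so continuity of the
    measure from below applies. *)
Lemma level_mass_left_continuous (c q : R) :
  (forall d, d < c -> level_mass f `]-oo, d[ <= q) -> level_mass f `]-oo, c[ <= q.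
Proof.
move=> H.
pose S n e := edge_level f `]-oo, (c - n.+1%:R^-1)[ e.
have mS n e : measurable (S n e) by exact: (measurable_edge_level Hf).
have Scvg e : (fun n => \int[mu]_(t in S n e) (1 : R)) @ \oo -->
    \int[mu]_(t in edge_level f `]-oo, c[ e) (1 : R).
  have UE : \bigcup_n S n e = edge_level f `]-oo, c[ e.
    apply/seteqP; split => t.
      move=> [n _ [te]]; rewrite /= in_itv /= => h; split => //=; rewrite in_itv /=.
      by apply: lt_le_trans h _; rewrite gerBl.
    move=> [te]; rewrite /= in_itv /= => h.
    have d0 : 0 < c - f e t by rewrite subr_gt0.
    exists (Num.bound (c - f e t)^-1) => //; split => //=; rewrite in_itv /=.
    rewrite ltrBrDl -ltrBrDr invf_plt ?posrE ?ltr0Sn//.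
    apply: lt_trans (archi_boundP _) _; first by rewrite invr_ge0 ltW.
    by rewrite ltr_nat.
  have muS : mu (S n e) @[n --> \oo] --> mu (edge_level f `]-oo, c[ e).
    rewrite -UE; apply: (@nondecreasing_cvg_mu _ _ _ mu (S ^~ e)).
    - by move=> n; exact: mS.
    - by apply: bigcupT_measurable => n; exact: mS.
    move=> i j ij; apply/subsetPset => t [te]; rewrite /= !in_itv /= => h.
    split => //=; rewrite in_itv /=; apply: lt_le_trans h _.
    by rewrite lerD2l lerN2 lef_pV2 ?posrE ?ltr0Sn// ler_nat.
  have mfin (A : set R) : measurable A -> A `<=` `[0, len e] -> (mu A < +oo)%E.
    move=> mA sA; apply: (@le_lt_trans _ _ (mu `[0, len e])).
      by apply: le_measure; rewrite ?inE//; exact: measurable_itv.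
    by rewrite lebesgue_measure_itv /=; case: ifP => _; rewrite ltry.
  have E (A : set R) : measurable A -> \int[mu]_(t in A) (1 : R) = fine (mu A).
    by move=> mA; rewrite Rintegral_cst// mul1r.
  rewrite E; last exact: (measurable_edge_level Hf).
  under eq_cvg => n do rewrite E//.
  apply: fine_cvg; rewrite fineK//.
  rewrite ge0_fin_numE//; apply: mfin; first exact: (measurable_edge_level Hf).
  by move=> t [].
have : (fun n => level_mass f `]-oo, (c - n.+1%:R^-1)[) @ \oo --> level_mass f `]-oo, c[.
  by apply: cvg_big => [|e _]; [exact: add_continuous|exact: Scvg].
move=> /cvgr_to_le; apply; near=> n; apply: H.
by rewrite gtrBl invr_gt0.
Unshelve. all: by end_near. Qed.
End Quantile.

Section Poincare.
Context {R : realType} (G : metric_graph R).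
Implicit Types (f : edge G -> R -> R) (J K : set R).

Lemma level_mass_split3 f (f' : edge G -> R -> R) (s t : R) :
  H1_graph f f' -> s <= t ->
  level_mass f `]-oo, s[ + level_mass f `[s, t] + level_mass f `]t, +oo[ =
  total_length G.
Proof.
move=> Hf st; rewrite -(level_mass_setT f).
have m1 : measurable (`]-oo, s[ : set R) by exact: measurable_itv.
have m2 : measurable (`[s, t] : set R) by exact: measurable_itv.
have m3 : measurable (`]t, +oo[ : set R) by exact: measurable_itv.
rewrite -!(level_massU Hf)//.
- congr level_mass; apply/seteqP; split => z //= _; rewrite !in_itv /= andbT.
  have [zs|sz] := ltP z s; first by left; left.
  by have [zt|tz] := leP z t; [left; right|right].
- exact: measurableU.
- rewrite -subset0 => z [[|]]; rewrite /= !in_itv /= andbT; lra.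
- rewrite -subset0 => z []; rewrite /= !in_itv /=; lra.
Qed.

(** [c] is the supremum of the levels in [[s, t]] with mass at most [q] below them. A single level
    may carry positive mass, so the quantile is described by two inequalities on open half-lines. *)
Lemma quantile_exists f (f' : edge G -> R -> R) (s t q : R) :
  H1_graph f f' -> s <= t -> level_mass f `]-oo, s[ <= q ->
  level_mass f `]t, +oo[ <= total_length G - q ->
  exists c, [/\ s <= c, c <= t, level_mass f `]-oo, c[ <= q &
                 level_mass f `]c, +oo[ <= total_length G - q].
Proof.
move=> Hf st sq tq.
pose A := [set z | s <= z <= t /\ level_mass f `]-oo, z[ <= q].
have As : A s by split; rewrite ?lexx.
have supA : has_sup A by split; [exists s|exists t => z [/andP[]]].
have sc : s <= sup A by apply: ub_le_sup; [exact: supA.2|].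
have ct : sup A <= t by apply: ge_sup; [exists s|move=> z [/andP[]]].
exists (sup A); split => //.
  apply: (level_mass_left_continuous Hf) => d dA.
  have [z [_ zq] dz] := @sup_adherent _ A (sup A - d) ltac:(lra) supA.
  apply: le_trans zq; apply: (le_level_mass Hf); try exact: measurable_itv.
  by move=> w; rewrite /= !in_itv /= => /lt_trans; apply; lra.
(* The mass above [c] is the mass below [- c] of the reflected function, so left continuity serves
   again: a level above [c] and up to [t] is not in [A] and has mass more than [q] below it. *)
have E (g : R) : level_mass f `]g, +oo[ = level_mass (graph_opp f) `]-oo, (- g)[.
  apply/esym/level_mass_opp => //.
  by move=> z; rewrite /= !in_itv /= andbT ltrNr.
rewrite E; apply: (level_mass_left_continuous (H1_graph_opp Hf)) => d dA.
rewrite -(opprK d) -E.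
have [dt|td] := leP (- d) t; last first.
  apply: le_trans tq; apply: (le_level_mass Hf); try exact: measurable_itv.
  by move=> w; rewrite /= !in_itv /= !andbT; lra.
have : ~ A (- d) by move=> Ad; have := ub_le_sup supA.2 Ad; lra.
have qd : q < level_mass f `]-oo, (- d)[.
  rewrite ltNge; apply/negP => h; have : A (- d); last
    by move=> /(ub_le_sup supA.2); lra.
  by split => //; lra.
move=> _; have := level_mass_split3 Hf (lexx (- d)).
have := level_mass_ge0 f `[- d, - d]; lra.
Qed.

End Poincare.

(** * The defect on either side of a shifted zero level *)

Section Poincare.
Context {R : realType} (G : metric_graph R).
Implicit Types (f : edge G -> R -> R) (J K : set R).

(** This is what the inequality uses of the graph: a range containing the values, whose levels are
    crossed at least once, and a band inside it whose levels are crossed at least twice. The case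
    [t1 = t2] serves for trees. *)
Record crossing_profile f (f' : edge G -> R -> R) (t0 t1 t2 t3 : R) : Prop := {
  profile_H1 : H1_graph f f';
  profile_le01 : t0 <= t1;
  profile_le12 : t1 <= t2;
  profile_le23 : t2 <= t3;
  profile_range : forall e t, 0 <= t <= len e -> t0 <= f e t <= t3;
  profile_crosses1 : crosses f f' 1 t0 t3;
  profile_crosses2 : crosses f f' 2 t1 t2 }.

Lemma profile_opp f (f' : edge G -> R -> R) (t0 t1 t2 t3 : R) :
  crossing_profile f f' t0 t1 t2 t3 ->
  crossing_profile (graph_opp f) (graph_opp f') (- t3) (- t2) (- t1) (- t0).
Proof.
move=> [H h01 h12 h23 r c1 c2]; split; rewrite ?lerN2//.
- exact: H1_graph_opp.
- by move=> e t /r; rewrite /graph_opp !lerN2 andbC.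
- exact: crosses_opp.
- exact: crosses_opp.
Qed.

Lemma defect_above_ge0 f (f' : edge G -> R -> R) (k t0 t1 t2 t3 c : R) :
  crossing_profile f f' t0 t1 t2 t3 -> 0 < k -> t0 <= c <= t3 ->
  let b := k * level_mass f `]Num.max t2 c, +oo[ in
  let phi := half_phase b + k * level_mass f (`[t1, t2] `&` `]c, +oo[) / 2 in
  b < pi / 2 -> phi < pi / 2 ->
  atan (2 * tan phi) + k * level_mass f `]c, t1[ < pi / 2 ->
  0 <= level_defect (graph_shift f c) f' k `]0, +oo[.
Proof.
move=> [H h01 h12 h23 r c1 c2] k0 /andP[ct0 ct3] b phi hb hphi hx.
(* The truncations at 0 treat the positions of [c] below, inside and above the band [[t1, t2]]
   together; the parts of the range below [c] become empty. *)
pose m := Num.max (t1 - c) 0; pose M := Num.max (t2 - c) 0.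
have mass_shift J K : (forall z, J (z - c) <-> K z) ->
    level_mass (graph_shift f c) J = level_mass f K.
  by move=> JK; apply: eq_level_integral => e t _; exact: JK.
have m0 : 0 <= m by rewrite le_max lexx orbT.
have mM : m <= M by rewrite ge_max !le_max lerB ?h12//= lexx orbT.
have Mt3 : M <= t3 - c by rewrite ge_max lerB//= subr_ge0.
have EM : level_mass (graph_shift f c) `]M, +oo[ = level_mass f `]Num.max t2 c, +oo[.
  apply: mass_shift => z; rewrite /= !in_itv /= !andbT !gt_max.
  by rewrite subr_gt0 ltrD2r.
have E2 : level_mass (graph_shift f c) (`[m, M] `&` `]0, +oo[) =
    level_mass f (`[t1, t2] `&` `]c, +oo[).
  apply: mass_shift => z; rewrite /= !in_itv /= !andbT ge_max le_max.
  by rewrite !lerD2r subr_gt0 subr_ge0 subr_le0; split; case; lra.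
have E1 : level_mass (graph_shift f c) `]0, m[ = level_mass f `]c, t1[.
  apply: mass_shift => z; rewrite /= !in_itv /= lt_max subr_gt0 ltrD2r subr_lt0.
  by split; lra.
apply: (level_defect_pos_ge0 (H1_graph_shift c H) k0 m0 mM Mt3);
  rewrite ?EM ?E2 ?E1//.
- by move=> e t /r /andP[_ h]; rewrite lerD2r.
- have := crosses_shift (c := c) c1 => /crosses_subset; apply; first
  by rewrite subr_le0.
  exact: le_trans Mt3.
- have [mM'|Mm] := ltP m M.
    have := crosses_shift (c := c) c2 => /crosses_subset; apply; first
      by rewrite le_max lexx.
    rewrite ge_max lexx /= leNgt; apply/negP => h.
    by have : M <= 0; [rewrite ge_max lexx (ltW h)|lra].
  by move=> x' y' h1 h2 h3; exfalso; lra.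
- have := crosses_shift (c := c) c1 => /crosses_subset; apply => //.
  by apply: le_trans (le_trans m0 mM); rewrite subr_le0.
Qed.

Lemma defect_below_ge0 f (f' : edge G -> R -> R) (k t0 t1 t2 t3 c : R) :
  crossing_profile f f' t0 t1 t2 t3 -> 0 < k -> t0 <= c <= t3 ->
  let a := k * level_mass f (`]-oo, (Num.min t1 c)[) in
  let phi := half_phase a + k * level_mass f (`[t1, t2] `&` `]-oo, c[) / 2 in
  a < pi / 2 -> phi < pi / 2 ->
  atan (2 * tan phi) + k * level_mass f `]t2, c[ < pi / 2 ->
  0 <= level_defect (graph_shift f c) f' k `]-oo, 0[.
Proof.
move=> P k0 /andP[ct0 ct3] a phi ha hphi hx.
have Ea : level_mass (graph_opp f) `]Num.max (- t1) (- c), +oo[ =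
    level_mass f `]-oo, (Num.min t1 c)[.
  apply: level_mass_opp => // z; rewrite -oppr_min /= !in_itv /= andbT.
  by rewrite ltrNl.
have E2 : level_mass (graph_opp f) (`[(- t2), (- t1)] `&` `]- c, +oo[) =
    level_mass f (`[t1, t2] `&` `]-oo, c[).
  apply: level_mass_opp => // z; rewrite /= !in_itv /= !andbT.
  by split; lra.
have E1 : level_mass (graph_opp f) `]- c, (- t2)[ = level_mass f `]t2, c[.
  apply: level_mass_opp => // z; rewrite /= !in_itv /=.
  by split; lra.
have := @defect_above_ge0 _ _ k _ _ _ _ (- c) (profile_opp P) k0.
rewrite Ea E2 E1 !lerN2 ct0 ct3 => /(_ isT ha hphi hx) /le_trans; apply.
rewrite /level_defect /level_energy /level_square.
set X := level_integral _ _ _; set Y := level_integral _ _ _.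
set X' := level_integral _ _ _; set Y' := level_integral _ _ _.
have XE : X = X'.
  transitivity (level_integral (graph_shift (graph_opp f) (- c)) (fun e t =>
    f' e t ^+ 2) `]0, +oo[).
    by apply: eq_bigr => e _; apply: eq_Rintegral => t _; rewrite /graph_opp sqrrN.
  apply: eq_level_integral => e t _;
    rewrite /graph_shift /graph_opp /= !in_itv /=; lra.
have YE : Y = Y'.
  transitivity (level_integral (graph_shift (graph_opp f) (- c)) (fun e t =>
    graph_shift f c e t ^+ 2) `]0, +oo[).
    apply: eq_bigr => e _; apply: eq_Rintegral => t _;
      rewrite /graph_opp /graph_shift.
    by rewrite -sqrrN; congr (_ ^+ 2); ring.
  apply: eq_level_integral => e t _;
    rewrite /graph_shift /graph_opp /= !in_itv /=; lra.
by rewrite XE YE.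
Qed.

(** On the level 0 itself the square vanishes and only energy remains. *)
Lemma level_defect_setT_ge0 f (f' : edge G -> R -> R) (k : R) : H1_graph f f' ->
  0 <= level_defect f f' k `]-oo, 0[ -> 0 <= level_defect f f' k `]0, +oo[ ->
  0 <= level_defect f f' k setT.
Proof.
move=> H h1 h2.
have m1 : measurable (`]-oo, 0[ : set R) by exact: measurable_itv.
have m2 : measurable (`[0, 0] : set R) by exact: measurable_itv.
have m3 : measurable (`]0, +oo[ : set R) by exact: measurable_itv.
have -> : [set: R] = (`]-oo, 0[ `|` `[0, 0]) `|` `]0, +oo[.
  apply/seteqP; split => z //= _; rewrite !in_itv /= andbT.
  have [z0|z0] := ltP z 0; first by left; left.
  by have [zt|tz] := leP z 0; [left; right|right].
have h0 : 0 <= level_defect f f' k `[0, 0].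
  rewrite subr_ge0; apply: le_trans (level_energy_ge0 _ _ _).
  rewrite mulr_ge0_le0 ?sqr_ge0//.
  have := @level_square_upper _ _ _ _ H 0 `[0, 0]%classic m2;
    rewrite expr0n mul0r; apply.
  by move=> z /=; rewrite in_itv /= => /andP[? ?]; rewrite normr_le0; apply/eqP;
    lra.
rewrite !(level_defectU H)//.
- by apply: addr_ge0 h2; exact: addr_ge0.
- rewrite -subset0 => z []; rewrite /= !in_itv /=; lra.
- exact: measurableU.
- rewrite -subset0 => z [[|]]; rewrite /= !in_itv /= andbT; lra.
Qed.
End Poincare.

(** * Choice of the zero level *)
Lemma atan_double_tan_le (R : realType) (x y : R) : 0 <= x -> x <= y ->
  y < pi / 2 ->
  atan (2 * tan x) <= atan (2 * tan y).
Proof.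
move=> x0 xy ypi; rewrite leNgt; apply/negP => /ltr_half_phase.
rewrite !half_phase_atan; lra.
Qed.

Lemma atan_double_tan_half_phase (R : realType) (x : R) : 0 <= x -> x < pi / 2 ->
  atan (2 * tan (half_phase x)) = x.
Proof.
move=> x0 xpi; rewrite tan_half_phase ?x0// mulrC divfK//.
by apply: tanK; rewrite in_itv /=; have := pi_gt0 R; lra.
Qed.

(** With at least a quarter wave below the band, the zero level is placed there: [x] lies below it,
    and [a - x], the band and [b] above. As [half_phase (pi - a) = pi - half_phase a], the
    hypothesis says that the phase [psi] with which the calibration leaves the band satisfies
    [a + psi < pi]. *)
Lemma phase_cut_outer (R : realType) (a th b : R) :
  pi / 2 <= a -> 0 <= th -> 0 <= b -> half_phase a + th + half_phase b < pi ->
  exists x, [/\ 0 <= x < pi / 2, x <= a, half_phase b + th < pi / 2 &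
                 atan (2 * tan (half_phase b + th)) + (a - x) < pi / 2].
Proof.
move=> ha th0 b0 h; have pi0 := pi_gt0 R; have Eb0 := half_phase_ge0 b0.
set phi := half_phase b + th.
have phi0 : 0 <= phi by rewrite addr_ge0.
have phi_lt : phi < half_phase (pi - a) by rewrite half_phaseB /phi; lra.
have phi_pi : phi < pi / 2.
  apply: lt_le_trans phi_lt _; rewrite -[leRHS]half_phase_pihalf.
  have ha' : pi - a <= pi / 2 by lra.
  by have := ler_half_phase ha'; lra.
have Epsi := half_phase_atan (_ : 0 <= phi < pi / 2); rewrite phi0 phi_pi in Epsi.
have {}Epsi := Epsi isT; set psi := atan _ in Epsi *.
have psi_lt : psi < pi - a.
  by rewrite ltNge; apply/negP => hh; have := ler_half_phase hh; lra.
have psi0 : 0 <= psi.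
  by rewrite leNgt; apply/negP => /ltr_half_phase; rewrite Epsi half_phase0; lra.
(* Each side receives half of the slack [pi - a - psi]. *)
exists (pi / 2 - (pi - a - psi) / 2); clear -ha pi0 phi_pi psi_lt psi0.
by split; lra.
Qed.

(** Here the zero level falls inside the band, and [x] is the share of [th] below it. *)
Lemma phase_cut_inner (R : realType) (a th b : R) :
  a < pi / 2 -> b < pi / 2 -> 0 <= th -> half_phase a + th + half_phase b < pi ->
  exists x, [/\ 0 <= x, x <= th, half_phase a + x < pi / 2 &
                 half_phase b + (th - x) < pi / 2].
Proof.
move=> ha hb th0 h.
have Ea := ltr_half_phase ha; have Eb := ltr_half_phase hb.
rewrite half_phase_pihalf in Ea Eb.
move: (half_phase a) (half_phase b) Ea Eb h => A B Ea Eb h {ha hb}.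
(* Ideally both sides miss [pi / 2] by half of the slack [pi - (A + th + B)]; where this would
   require [x > th] or [x < 0], [x] is cut off at [th] or 0. *)
have [hA|hA] := leP (A + th) (pi / 2 - (pi - (A + th + B)) / 2).
  by exists th; split; lra.
have [hB|hB] := leP (pi / 2 - (pi - (A + th + B)) / 2) A.
  by exists 0; split; lra.
by exists (pi / 2 - (pi - (A + th + B)) / 2 - A); split; lra.
Qed.

(** * The shifted Poincare inequality *)

Section Poincare.
Context {R : realType} (G : metric_graph R).
Implicit Types (f : edge G -> R -> R) (J K : set R).

Lemma level_mass_split f (f' : edge G -> R -> R) (c : R) : H1_graph f f' ->
  level_mass f `]-oo, c] + level_mass f `]c, +oo[ = total_length G.
Proof.
move=> H; rewrite -(level_mass_setT f) -(level_massU H);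
  [|exact: measurable_itv..|].
- congr level_mass; apply/seteqP; split => z //= _; rewrite !in_itv /= andbT.
  by have [zt|tz] := leP z c; [left|right].
- rewrite -subset0 => z []; rewrite /= !in_itv /= andbT; lra.
Qed.

Lemma level_mass_empty f J : (forall z, ~ J z) -> level_mass f J = 0.
Proof.
move=> J0; rewrite (_ : J = set0); first exact: level_integral_set0.
by rewrite -subset0 => z /J0.
Qed.

Lemma level_mass_oo0 f (a b : R) : b <= a -> level_mass f `]a, b[ = 0.
Proof.
by move=> ba; apply: level_mass_empty => z; rewrite /= in_itv /= => /andP[]; lra.
Qed.

Lemma level_mass_below0 f (t1 t2 c : R) : c <= t1 ->
  level_mass f (`[t1, t2] `&` `]-oo, c[) = 0.
Proof.
by move=> ct; apply: level_mass_empty => z []; rewrite /= !in_itv /=; lra.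
Qed.

Lemma level_mass_oc_split f (f' : edge G -> R -> R) (c t : R) :
  H1_graph f f' -> c < t ->
  level_mass f (`]-oo, t[) = level_mass f (`]-oo, c]) + level_mass f `]c, t[.
Proof.
move=> H ct; rewrite -(level_massU H); [|exact: measurable_itv..|].
- congr level_mass; apply/seteqP; split => z /=; rewrite !in_itv /=.
    by move=> zt; have [zc|cz] := leP z c; [left|right].
  by case; lra.
- by rewrite -subset0 => z []; rewrite /= !in_itv /=; lra.
Qed.

Lemma level_mass_below_split f (f' : edge G -> R -> R) (t1 t2 c : R) :
  H1_graph f f' -> t1 <= c -> c <= t2 ->
  level_mass f (`]-oo, c[) =
  level_mass f (`]-oo, t1[) + level_mass f (`[t1, t2] `&` `]-oo, c[).
Proof.
move=> H tc ct; rewrite -(level_massU H);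
  [|exact: measurable_itv|by apply: measurableI; exact: measurable_itv|].
- congr level_mass; apply/seteqP; split => z /=; rewrite !in_itv /=.
    by move=> zt; have [zc|cz] := ltP z t1; [left|right; split=> //; lra].
  by case; lra.
- by rewrite -subset0 => z []; rewrite /= !in_itv /= => ? []; lra.
Qed.

Lemma level_mass_above_split f (f' : edge G -> R -> R) (t1 t2 c : R) :
  H1_graph f f' -> t1 <= c -> c <= t2 ->
  level_mass f `]c, +oo[ =
  level_mass f (`[t1, t2] `&` `]c, +oo[) + level_mass f `]t2, +oo[.
Proof.
move=> H tc ct; rewrite -(level_massU H); [|by apply: measurableI;
  exact: measurable_itv|exact: measurable_itv|].
- congr level_mass; apply/seteqP; split => z /=; rewrite !in_itv /= !andbT.
    by move=> zt; have [zc|cz] := leP z t2; [left; split=> //; lra|right].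
  by case; lra.
- by rewrite -subset0 => z []; rewrite /= !in_itv /= => -[]; lra.
Qed.

Lemma mulr_level_mass_ge0 f (k : R) J : 0 < k -> 0 <= k * level_mass f J.
Proof. by move=> k0; rewrite mulr_ge0 ?(ltW k0) ?level_mass_ge0. Qed.

Lemma level_mass_below_range f (t0 : R) :
  (forall e t, 0 <= t <= len e -> t0 <= f e t) -> level_mass f (`]-oo, t0[) = 0.
Proof.
move=> r; transitivity (level_mass f set0); last by apply: level_mass_empty => z.
apply: eq_level_integral => e t /r h.
by rewrite /= in_itv /=; split => //; rewrite ltNge h.
Qed.

(** The zero level is the quantile with [x / k] of the length below it. It does not exceed [t1], so
    only single levels lie below it and [half_phase] and [atan] cancel there; above it come the
    remaining single levels, the band and the top. *)
Lemma poincare_shift_outer f (f' : edge G -> R -> R) (k t0 t1 t2 t3 : R) :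
  crossing_profile f f' t0 t1 t2 t3 -> 0 < k ->
  pi / 2 <= k * level_mass f (`]-oo, t1[) ->
  k * level_mass f `]t2, +oo[ < pi / 2 ->
  half_phase (k * level_mass f (`]-oo, t1[)) + k * level_mass f `[t1, t2] / 2
    + half_phase (k * level_mass f `]t2, +oo[) < pi ->
  exists c, 0 <= level_defect (graph_shift f c) f' k setT.
Proof.
move=> P k0 ha hb hth; have [H h01 h12 h23 r _ _] := P.
have b0 := mulr_level_mass_ge0 f `]t2, +oo[ k0.
have th0 : 0 <= k * level_mass f `[t1, t2] / 2.
  by apply: divr_ge0 => //; exact: mulr_level_mass_ge0.
have [x [/andP[x0 xpi] xa phi_pi psi_pi]] := phase_cut_outer ha th0 b0 hth.
have kq : k * (x / k) = x by rewrite mulrC divfK ?gt_eqF.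
have [c [t0c ct1 cq qc]] : exists c, [/\ t0 <= c, c <= t1,
    k * level_mass f (`]-oo, c[) <= x & x <= k * level_mass f (`]-oo, c])].
  have s0 : level_mass f (`]-oo, t0[) <= x / k.
    by rewrite level_mass_below_range ?divr_ge0 ?(ltW k0)// => e t /r /andP[].
  have s1 : level_mass f `]t1, +oo[ <= total_length G - x / k.
    have := level_mass_split3 H (lexx t1); have := level_mass_ge0 f `[t1, t1].
    have : x / k <= level_mass f (`]-oo, t1[) by rewrite ler_pdivrMr// mulrC.
    clear; lra.
  have [c [t0c ct1 cq qc]] := quantile_exists H h01 s0 s1.
  exists c; split => //; first by rewrite -kq ler_pM2l.
  by rewrite -kq ler_pM2l//; have := level_mass_split c H; clear -qc; lra.
have cI : t0 <= c <= t3 by rewrite t0c (le_trans ct1)// (le_trans h12).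
have E21 : Num.max t2 c = t2 by apply: max_idPl; exact: le_trans h12.
have E12 : Num.min t1 c = c by apply: min_idPr.
have a0 := mulr_level_mass_ge0 f (`]-oo, c[) k0.
have a_pi := le_lt_trans cq xpi.
exists c; apply: level_defect_setT_ge0 (H1_graph_shift c H) _ _.
- apply: (defect_below_ge0 P k0 cI);
  rewrite E12 ?level_mass_below0// mulr0 mul0r addr0.
  + by rewrite -[ltRHS]half_phase_pihalf; exact: ltr_half_phase.
  + rewrite level_mass_oo0 ?mulr0 ?addr0; last exact: le_trans h12.
    by rewrite atan_double_tan_half_phase.
- have mle : k * level_mass f (`[t1, t2] `&` `]c, +oo[) <=
  k * level_mass f `[t1, t2].
    rewrite ler_pM2l//; apply: (le_level_mass H).
    + by apply: measurableI; exact: measurable_itv.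
    + exact: measurable_itv.
    + exact: subIsetl.
  apply: (defect_above_ge0 P k0 cI); rewrite E21 //.
  + by apply: le_lt_trans phi_pi; rewrite lerD2l ler_pM2r.
  + apply: le_lt_trans psi_pi; apply: lerD.
      apply: atan_double_tan_le => //; last by rewrite lerD2l ler_pM2r.
      by apply: addr_ge0; [exact: half_phase_ge0|apply: divr_ge0 => //;
        exact: mulr_level_mass_ge0].
    have [ct|tc] := ltP c t1; last by rewrite level_mass_oo0// mulr0 subr_ge0.
    by rewrite (level_mass_oc_split H ct) mulrDr; clear -qc; lra.
Qed.

Lemma poincare_shift_inner f (f' : edge G -> R -> R) (k t0 t1 t2 t3 : R) :
  crossing_profile f f' t0 t1 t2 t3 -> 0 < k ->
  k * level_mass f (`]-oo, t1[) < pi / 2 ->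
  k * level_mass f `]t2, +oo[ < pi / 2 ->
  half_phase (k * level_mass f (`]-oo, t1[)) + k * level_mass f `[t1, t2] / 2
    + half_phase (k * level_mass f `]t2, +oo[) < pi ->
  exists c, 0 <= level_defect (graph_shift f c) f' k setT.
Proof.
move=> P k0 ha hb hth; have [H h01 h12 h23 r _ _] := P.
have th0 : 0 <= k * level_mass f `[t1, t2] / 2.
  by apply: divr_ge0 => //; exact: mulr_level_mass_ge0.
have [x [x0 xth xa xb]] := phase_cut_inner ha hb th0 hth.
(* Levels in the band are covered twice and their mass counts half in the phase, so a share [x] of
   the phase corresponds to the mass [2 * x / k]. *)
pose q := (k * level_mass f (`]-oo, t1[) + 2 * x) / k.
have kq : k * q = k * level_mass f (`]-oo, t1[) + 2 * x
  by rewrite /q mulrC divfK ?gt_eqF.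
have kL := congr1 (fun z => k * z) (level_mass_split3 H h12).
rewrite /= !mulrDr in kL.
have s1 : level_mass f (`]-oo, t1[) <= q by rewrite -(ler_pM2l k0) kq; clear -x0;
  lra.
have s2 : level_mass f `]t2, +oo[ <= total_length G - q.
  by rewrite -(ler_pM2l k0) mulrBr kq; clear -kL xth; lra.
have [c [t1c ct2 cq qc]] := quantile_exists H h12 s1 s2.
rewrite -(ler_pM2l k0) kq in cq; rewrite -(ler_pM2l k0) mulrBr kq in qc.
have cI : t0 <= c <= t3 by rewrite (le_trans h01)// (le_trans ct2).
exists c; apply: level_defect_setT_ge0 (H1_graph_shift c H) _ _.
- apply: (defect_below_ge0 P k0 cI); rewrite (min_idPl t1c)//.
  + rewrite (level_mass_below_split H t1c ct2) mulrDr in cq.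
    by clear -cq xa; lra.
  + by rewrite level_mass_oo0// mulr0 addr0 atan_ltpi2.
- apply: (defect_above_ge0 P k0 cI); rewrite (max_idPl ct2)//.
  + rewrite (level_mass_above_split H t1c ct2) mulrDr in qc.
    by clear -qc xb kL; lra.
  + by rewrite level_mass_oo0// mulr0 addr0 atan_ltpi2.
Qed.

Lemma poincare_shift f (f' : edge G -> R -> R) (k t0 t1 t2 t3 : R) :
  crossing_profile f f' t0 t1 t2 t3 -> 0 < k ->
  half_phase (k * level_mass f (`]-oo, t1[)) + k * level_mass f `[t1, t2] / 2
    + half_phase (k * level_mass f `]t2, +oo[) < pi ->
  exists c, 0 <= level_defect (graph_shift f c) f' k setT.
Proof.
move=> P k0 h; have [hb|hb] := ltP (k * level_mass f `]t2, +oo[) (pi / 2).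
  have [ha|ha] := ltP (k * level_mass f (`]-oo, t1[)) (pi / 2).
    exact: poincare_shift_inner P k0 ha hb h.
  exact: poincare_shift_outer P k0 ha hb h.
have E1 : level_mass (graph_opp f) (`]-oo, (- t2)[) = level_mass f `]t2, +oo[.
  by apply: level_mass_opp => // z; rewrite /= !in_itv /= andbT ltrNr.
have E2 : level_mass (graph_opp f) `[(- t2), (- t1)] = level_mass f `[t1, t2].
  by apply: level_mass_opp => // z; rewrite /= !in_itv /= lerNl lerNr andbC.
have E3 : level_mass (graph_opp f) `](- t1), +oo[ = level_mass f (`]-oo, t1[).
  by apply: level_mass_opp => // z; rewrite /= !in_itv /= andbT ltrNl.
have th0 := mulr_level_mass_ge0 f `[t1, t2] k0.
(* Quarter waves on both sides would already add up to a phase of [pi]. *)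
have ha : k * level_mass f (`]-oo, t1[) < pi / 2.
  rewrite ltNge; apply/negP => ha.
  have := ler_half_phase ha; have := ler_half_phase hb.
  by rewrite half_phase_pihalf; clear -th0 ha hb h; lra.
have := poincare_shift_outer (profile_opp P) k0; rewrite E1 E2 E3 => /(_ hb ha).
have h' : half_phase (k * level_mass f `]t2, +oo[) + k * level_mass f `[t1, t2] / 2
    + half_phase (k * level_mass f (`]-oo, t1[)) < pi by clear -h; lra.
move=> /(_ h') [c hc]; exists (- c); move: hc.
rewrite (_ : level_defect _ _ _ _ = level_defect (graph_shift f (- c)) f' k setT)//.
congr (_ - _ * _); apply: eq_bigr => e _; apply: eq_Rintegral => t _.
  by rewrite /graph_opp sqrrN.
by rewrite /graph_shift /graph_opp -sqrrN; congr (_ ^+ 2); ring.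
Qed.

(** Superadditivity merges the parts below and above the band into one pendant edge, and the slope
    bound allows the mass of the band beyond [V] to be moved to it. Neither operation lowers the
    phase. *)
Lemma poincare_tadpole f (f' : edge G -> R -> R) (k V t0 t1 t2 t3 : R) :
  crossing_profile f f' t0 t1 t2 t3 -> 0 < k -> 0 <= V ->
  V <= level_mass f `[t1, t2] ->
  half_phase (k * (total_length G - V)) + k * V / 2 < pi ->
  exists c, 0 <= level_defect (graph_shift f c) f' k setT.
Proof.
move=> P k0 V0 hV hph; have [H h01 h12 h23 r _ _] := P.
apply: (poincare_shift P k0).
have a0 := mulr_level_mass_ge0 f (`]-oo, t1[) k0.
have b0 := mulr_level_mass_ge0 f `]t2, +oo[ k0.
have kL := congr1 (fun z => k * z) (level_mass_split3 H h12).
have kV : k * V <= k * level_mass f `[t1, t2] by rewrite ler_pM2l.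
have kV0 : 0 <= k * V by rewrite mulr_ge0// ltW.
move: a0 b0 kL kV kV0 hph; rewrite /= !mulrDr mulrN.
move: (k * level_mass f (`]-oo, t1[)) (k * level_mass f `[t1, t2]) => a th.
move: (k * level_mass f `]t2, +oo[) (k * total_length G) (k * V) => b l v.
clear => a0 b0 kL kV kV0 hph.
(* Superadditivity is available only up to [pi]; a pendant edge reaching [pi] would violate the
   phase hypothesis on its own. *)
have lpi : l - v < pi.
  rewrite ltNge; apply/negP => /[dup] hl /ler_half_phase; rewrite half_phase_pi;
    lra.
have ab : a + b <= l - v by lra.
have h1 := ler_half_phase ab.
have h2 := half_phase_superadditive a0 b0 ltac:(lra).
by clear -h1 h2 hph kL; lra.
Qed.
End Poincare.

(** * Crossings of levels *)
Lemma clamp_le (R : realDomainType) (x y z : R) : x <= y -> z <= x ->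
  clamp x y z = x.
Proof.
by move=> xy zx; rewrite /clamp (min_idPr (le_trans zx xy)) (max_idPl zx).
Qed.

Lemma clamp_ge (R : realDomainType) (x y z : R) : x <= y -> y <= z ->
  clamp x y z = y.
Proof. by move=> xy yz; rewrite /clamp (min_idPl yz) (max_idPr xy). Qed.

Lemma cycle_telescope (R : zmodType) (T : eqType) (V : eqType) (s t : T -> V)
    (h : V -> R) (p : seq T) : cycle (fun d d' => t d == s d') p ->
  \sum_(d <- p) (h (t d) - h (s d)) = 0.
Proof.
case: p => [|d p]; first by rewrite big_nil.
rewrite /cycle rcons_path => /andP[pth /eqP lst].
suff -> : \sum_(d' <- d :: p) (h (t d') - h (s d')) = h (t (last d p)) - h (s d).
  by rewrite lst subrr.
elim: p d pth {lst} => [|d' p IH] d /=; first by rewrite big_cons big_nil addr0.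
by move=> /andP[/eqP dd' pth]; rewrite big_cons IH// dd' addrC addrA subrK.
Qed.

Section Edges.
Context {R : realType} (G : metric_graph R).
Notation mu := (@lebesgue_measure R).
Variables (f f' : edge G -> R -> R).
Hypothesis Hf : H1_graph f f'.

Definition edge_variation (x y : R) (e : edge G) :=
  \int[mu]_(t in edge_level f `]x, y[ e) `|f' e t|.

Lemma edge_variation_integrable x y e :
  mu.-integrable (edge_level f `]x, y[ e) (EFin \o (fun t => `|f' e t|)).
Proof.
have := edge_integrable_norm_deriv Hf =>
  /(@edge_level_integrable _ _ _ _ Hf `]x, y[%classic).
by apply; exact: measurable_itv.
Qed.

Let piece (x y : R) e (a b : R) := `]a, b[ `&` f e @^-1` `]x, y[.

Lemma edge_crossing_piece e (a b x y : R) : 0 <= a -> a <= b -> b <= len e ->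
  x <= y ->
  `|clamp x y (f e b) - clamp x y (f e a)| <=
    \int[mu]_(t in piece x y e a b) `|f' e t|.
Proof. by move=> *; apply: H1_crossing (Hf.1 e) _ _ _ _. Qed.

Let piece_sub (x y : R) e (a b : R) : 0 <= a -> b <= len e ->
  piece x y e a b `<=` edge_level f `]x, y[ e.
Proof.
move=> a0 bl t [/=]; rewrite !in_itv /= => /andP[at_ tb] fxy; split => //=.
by rewrite in_itv /=; rewrite (le_trans a0 (ltW at_)) (le_trans (ltW tb)).
Qed.

Let measurable_piece (x y : R) e (a b : R) : 0 <= a -> b <= len e ->
  measurable (piece x y e a b).
Proof.
move=> a0 bl; rewrite (_ : piece _ _ _ _ _ = `]a, b[ `&` edge_level f `]x, y[ e).
  by apply: measurableI; [exact: measurable_itv|exact: (measurable_edge_level Hf)].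
apply/seteqP; split => t; last by move=> [? []].
by move=> tp; split; [case: tp|exact: piece_sub tp].
Qed.

Lemma le_piece_variation (x y : R) e (a b : R) : 0 <= a -> b <= len e ->
  \int[mu]_(t in piece x y e a b) `|f' e t| <= edge_variation x y e.
Proof.
move=> a0 bl; apply: ge0_subset_Rintegral => //.
- exact: measurable_piece.
- exact: (measurable_edge_level Hf).
- exact: piece_sub.
- exact: edge_variation_integrable.
Qed.

Lemma edge_variation_ends x y e : x <= y ->
  `|clamp x y (f e (len e)) - clamp x y (f e 0)| <= edge_variation x y e.
Proof.
move=> xy; have l0 := ltW (len_gt0 e).
exact: le_trans (edge_crossing_piece (lexx 0) l0 (lexx _) xy) (le_piece_variation _ _ _ _).
Qed.

Lemma edge_variation_once x y e (p q : R) : x <= y ->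
  0 <= p <= len e -> 0 <= q <= len e -> f e p <= x -> y <= f e q ->
  y - x <= edge_variation x y e.
Proof.
move=> xy /andP[p0 pl] /andP[q0 ql] fp fq.
have cp := clamp_le xy fp; have cq := clamp_ge xy fq.
have [pq|/ltW qp] := leP p q.
- have := edge_crossing_piece p0 pq ql xy; rewrite cp cq => h.
  by apply: le_trans (ler_norm _) (le_trans h (le_piece_variation _ _ _ _)).
- have := edge_crossing_piece q0 qp pl xy; rewrite cp cq distrC => h.
  by apply: le_trans (ler_norm _) (le_trans h (le_piece_variation _ _ _ _)).
Qed.

(** The clamped values at [0], [a], [b], [len e] and back at [0] form a closed walk containing a
    step of length [y - x], and a closed walk has at least twice that length. The closing jump is
    left for the rest of a cycle to supply. *)
Lemma edge_variation_twice x y e (p q : R) : x <= y ->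
  0 <= p <= len e -> 0 <= q <= len e -> f e p <= x -> y <= f e q ->
  2 * (y - x) <= edge_variation x y e +
    `|clamp x y (f e (len e)) - clamp x y (f e 0)|.
Proof.
move=> xy pI qI fp fq.
have cp := clamp_le xy fp; have cq := clamp_ge xy fq.
have [a [b [a0 ab bl cab]]] : exists a b, [/\ 0 <= a, a <= b, b <= len e &
    `|clamp x y (f e b) - clamp x y (f e a)| = y - x].
  have [pq|/ltW qp] := leP p q.
    by exists p, q; rewrite cp cq ger0_norm ?subr_ge0//; case/andP: pI;
      case/andP: qI.
  by exists q, p; rewrite cp cq distrC ger0_norm ?subr_ge0//; case/andP: pI;
    case/andP: qI.
have h1 := edge_crossing_piece (lexx 0) a0 (le_trans ab bl) xy.
have h2 := edge_crossing_piece a0 ab bl xy.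
have h3 := edge_crossing_piece (le_trans a0 ab) bl (lexx _) xy.
have m1 := measurable_piece x y (e := e) (lexx 0) (le_trans ab bl).
have m2 := measurable_piece x y (e := e) a0 bl.
have m3 := measurable_piece x y (e := e) (le_trans a0 ab) (lexx _).
have sum : \int[mu]_(t in piece x y e 0 a) `|f' e t| +
  \int[mu]_(t in piece x y e a b) `|f' e t|
   + \int[mu]_(t in piece x y e b (len e)) `|f' e t| <= edge_variation x y e.
  have sub : (piece x y e 0 a `|` piece x y e a b) `|` piece x y e b (len e)
     `<=` edge_level f `]x, y[ e.
    by move=> t [[|]|]; apply: piece_sub => //; lra.
  have int : mu.-integrable (edge_level f `]x, y[ e) (EFin \o (fun t => `|f' e t|)).
    exact: edge_variation_integrable.
  have mE : measurable (edge_level f `]x, y[ e)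
    by exact: (measurable_edge_level Hf).
  rewrite -Rintegral_setU//; last 2 first.
  - apply: integrableS int => //; first exact: measurableU.
    by apply: subset_trans sub; exact: subsetUl.
  - apply/disj_setPS => t [[/= + _] [/= + _]]; rewrite !in_itv /=; lra.
  rewrite -Rintegral_setU//; last 3 first.
  - exact: measurableU.
  - by apply: integrableS int => //; apply: measurableU => //; exact: measurableU.
  - apply/disj_setPS => t [[|] [/= + _] [/= + _]]; rewrite !in_itv /=; lra.
  apply: ge0_subset_Rintegral => //.
  by apply: measurableU => //; exact: measurableU.
move: h1 h2 h3 sum cab.
move: (clamp x y (f e (len e))) (clamp x y (f e 0)) (clamp x y (f e a)) (clamp x y (f e b)).
move=> cl c0 ca cb h1 h2 h3 sum cab.
have t2 := ler_distD cl cb c0.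
have t3 := ler_distD c0 cb ca.
rewrite (distrC cb cl) (distrC c0 ca) in t2 t3.
lra.
Qed.
End Edges.

Section Crossings.
Context {R : realType} (G : metric_graph R).
Notation mu := (@lebesgue_measure R).
Variables (f f' : edge G -> R -> R).
Hypothesis Hf : H1_graph f f'.

Lemma edge_variation_ge0 x y e : 0 <= edge_variation f f' x y e.
Proof. by apply: Rintegral_ge0. Qed.

Lemma ler_edge_variation x y e : edge_variation f f' x y e <=
  level_variation f f' `]x, y[.
Proof.
rewrite /level_variation /level_integral (bigD1 e)//= lerDl.
by apply: sumr_ge0 => *; exact: edge_variation_ge0.
Qed.

(** The clamped increments along the cycle sum to 0, so the other edges make up for the net
    increment of [e]. Their variation is at least the closing jump in [edge_variation_twice], and as
    the edges are distinct, nothing is counted twice. *)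
Lemma cycle_variation x y (p : seq (edge G * bool)) e (s t : R) :
  x <= y -> simple_closed_path p -> e \in [seq d.1 | d <- p] ->
  0 <= s <= len e -> 0 <= t <= len e -> f e s <= x -> y <= f e t ->
  2 * (y - x) <= level_variation f f' `]x, y[.
Proof.
move=> xy /and3P[cyc _ uniq_edges] /mapP[d0 d0p ->] sI tI fs ft.
have [_ [u Hu]] := Hf.
have uniq_p := map_uniq uniq_edges.
have tele := cycle_telescope (fun v => clamp x y (u v)) cyc.
rewrite (bigD1_seq d0)//= in tele.
have ends (d : edge G * bool) :
    `|clamp x y (u (dart_tgt d)) - clamp x y (u (dart_src d))| =
    `|clamp x y (f d.1 (len d.1)) - clamp x y (f d.1 0)|.
  have [-> ->] := Hu d.1; rewrite /dart_tgt /dart_src; case: d.2 => //.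
  by rewrite distrC.
have d0_le : `|clamp x y (f d0.1 (len d0.1)) - clamp x y (f d0.1 0)| <=
    \sum_(d <- p | d != d0) edge_variation f f' x y d.1.
  rewrite -ends -normrN (addr0_eq tele); apply: le_trans (ler_norm_sum _ _ _) _.
  by apply: ler_sum => d _; rewrite ends; exact: edge_variation_ends.
have d0_ge := edge_variation_twice Hf xy sI tI fs ft.
apply: (@le_trans _ _ (\sum_(d <- p) edge_variation f f' x y d.1)).
  by rewrite (bigD1_seq d0)//=; apply: le_trans d0_ge _; rewrite lerD2l.
rewrite -(big_map (fun d => d.1) xpredT (edge_variation f f' x y)).
rewrite big_uniq//= /level_variation /level_integral [leRHS](bigID (mem [seq d.1 | d <- p]))/=.
by rewrite lerDl; apply: sumr_ge0 => *; exact: edge_variation_ge0.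
Qed.

(** Cutting at a breakpoint splits the left side exactly and cannot increase the variation, so
    finitely many breakpoints can be inserted one at a time. *)
Lemma crosses_breakpoints (n x y : R) (s : seq R) :
  (forall x' y', x <= x' -> x' < y' -> y' <= y -> (forall z, z \in s ->
    ~~ (x' < z < y')) ->
     n * (y' - x') <= level_variation f f' `]x', y'[) ->
  crosses f f' n x y.
Proof.
elim: s => [H x' y' xx xy yy|b s IH H]; first exact: H.
apply: IH => x' y' xx xy yy Hs.
have [/andP[xb b_y]|nb] := boolP (x' < b < y'); last first.
  by apply: H => // z; rewrite inE => /predU1P[->|/Hs].
have h1 : n * (b - x') <= level_variation f f' `]x', b[.
  apply: H => //; first exact: le_trans (ltW b_y) yy.
  move=> z; rewrite inE => /predU1P[->|/Hs]; first by rewrite ltxx andbF.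
  by apply: contra => /andP[-> zb]; rewrite (lt_trans zb b_y).
have h2 : n * (y' - b) <= level_variation f f' `]b, y'[.
  apply: H => //; first exact: le_trans xx (ltW xb).
  move=> z; rewrite inE => /predU1P[->|/Hs]; first by rewrite ltxx.
  by apply: contra => /andP[bz ->]; rewrite (lt_trans xb bz).
have : level_variation f f' `]x', b[ + level_variation f f' `]b, y'[ <=
    level_variation f f' `]x', y'[.
  have iF := edge_integrable_norm_deriv Hf.
  rewrite -(level_integralU Hf iF); [|exact: measurable_itv..|].
    apply: (level_integral_subset Hf iF) => //.
    + by apply: measurableU; exact: measurable_itv.
    + by move=> z [|] /=; rewrite !in_itv /= => /andP[h3 h4];
        rewrite ?h3 ?h4 ?(lt_trans h4 b_y) ?(lt_trans xb h3).
  by rewrite -subset0 => z [/=]; rewrite !in_itv /= => /andP[h3 h4] /andP[h5 h6];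
    move: (lt_trans h4 h5); rewrite ltxx.
by clear -h1 h2; lra.
Qed.

(** If the level [z] were missed, then by the intermediate value theorem every edge of the component
    would lie entirely below or entirely above [z], and adjacent edges on the same side,
    contradicting [f e1 p <= z <= f e2 q]. *)
Lemma component_level_attained (A : pred (edge G)) e0 e1 e2 (p q z : R) :
  component A e0 e1 -> component A e0 e2 ->
  0 <= p <= len e1 -> 0 <= q <= len e2 -> f e1 p <= z -> z <= f e2 q ->
  exists2 e, component A e0 e & exists2 t, 0 <= t <= len e & f e t = z.
Proof.
move=> c1 c2 pI qI fp fq; apply: contrapT => none.
have side e s t : component A e0 e -> 0 <= s <= len e -> 0 <= t <= len e ->
    f e s < z -> f e t < z.
  move=> ce sI tI fs; rewrite ltNge; apply/negP => ft; apply: none; exists e => //.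
  have cf := @edge_continuous _ _ _ _ Hf e.
  have [st|/ltW ts] := leP s t.
  - have cst : {within `[s, t], continuous (f e)}.
      apply: continuous_subspaceW cf; apply: subset_itv; rewrite bnd_simp.
      + by case/andP: sI.
      + by case/andP: tI.
    have [|w] := IVT st cst (v := z).
      by rewrite ge_min le_max (ltW fs) ft orbT.
    rewrite in_itv /= => /andP[sw wt] fw; exists w => //.
    by move: sI tI => /andP[s0 _] /andP[_ tl];
      rewrite (le_trans s0 sw) (le_trans wt tl).
  - have cst : {within `[t, s], continuous (f e)}.
      apply: continuous_subspaceW cf; apply: subset_itv; rewrite bnd_simp.
      + by case/andP: tI.
      + by case/andP: sI.
    have [|w] := IVT ts cst (v := z).
      by rewrite ge_min le_max (ltW fs) ft !orbT.
    rewrite in_itv /= => /andP[sw wt] fw; exists w => //.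
    by move: sI tI => /andP[_ sl] /andP[t0 _];
      rewrite (le_trans t0 sw) (le_trans wt sl).
have [_ [u Hu]] := Hf.
have I0 (e : edge G) : 0 <= (0 : R) <= len e by rewrite lexx (ltW (len_gt0 e)).
have Il (e : edge G) : 0 <= len e <= len e by rewrite lexx (ltW (len_gt0 e)).
have const v : connect (adjacent_via A) (src e0) v -> (u v < z) = (u (src e0) < z).
  move=> /connectP[pth]; elim/last_ind: pth v => [|pth w IH] v; first
    by move=> _ ->.
  rewrite rcons_path last_rcons => /andP[pp adj] ->.
  set x := last _ _ in adj; rewrite -(IH x pp erefl).
  have cx : connect (adjacent_via A) (src e0) x by apply/connectP; exists pth.
  have cw : connect (adjacent_via A) (src e0) w
    by apply: connect_trans cx (connect1 adj).
  move: adj => /existsP[e /andP[Ae /orP[]] /andP[/eqP E1 /eqP E2]].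
  - have ce : component A e0 e by rewrite /component Ae E1.
    rewrite -E1 -E2; have [<- <-] := Hu e.
    by apply/idP/idP; apply: side.
  - have ce : component A e0 e by rewrite /component Ae E1.
    rewrite -E1 -E2; have [<- <-] := Hu e.
    by apply/idP/idP; apply: side.
have fp' : f e1 p < z.
  by rewrite lt_neqAle fp andbT; apply/eqP => h; apply: none; exists e1 => //;
    exists p.
have u1 : u (src e1) < z.
  by have [<- _] := Hu e1; exact: side _ _ _ c1 pI (I0 e1) fp'.
have u2 : ~~ (u (src e2) < z).
  have [<- _] := Hu e2; apply/negP => h.
  by have := side _ _ _ c2 (I0 e2) qI h; rewrite ltNge fq.
by move: u2; rewrite const -?(const (src e1)) ?u1//; [case/andP: c1|case/andP: c2].
Qed.

Lemma edge_range_exists : exists m M : edge G -> R, forall e,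
  [/\ forall t, 0 <= t <= len e -> m e <= f e t <= M e,
      exists2 t, 0 <= t <= len e & f e t = m e &
      exists2 t, 0 <= t <= len e & f e t = M e].
Proof.
have H e : exists mM : R * R,
  [/\ forall t, 0 <= t <= len e -> mM.1 <= f e t <= mM.2,
      exists2 t, 0 <= t <= len e & f e t = mM.1 &
      exists2 t, 0 <= t <= len e & f e t = mM.2].
  have cf := @edge_continuous _ _ _ _ Hf e; have l0 := ltW (len_gt0 e).
  have [a aI ha] := EVT_min l0 cf; have [b bI hb] := EVT_max l0 cf.
  exists (f e a, f e b); rewrite in_itv /= in aI; rewrite in_itv /= in bI.
  by split; [move=> t tI; rewrite ha ?hb ?in_itv//|exists a|exists b].
have [mM HM] := choice H.
by exists (fun e => (mM e).1), (fun e => (mM e).2).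
Qed.

End Crossings.

(** [t0] and [t3] are the extremes of [f] on the graph, and [t1] and [t2] those on the given
    component if there is one. Connectedness yields the single crossings, and the cycles through the
    edges of the component the double ones. *)
Lemma graph_profile (R : realType) (G : metric_graph R) (f f' : edge G -> R ->
  R) (V : R) :
  connected_graph G -> 0 < total_length G ->
    doubly_connected_component_length G V ->
  H1_graph f f' ->
  exists t0 t1 t2 t3, crossing_profile f f' t0 t1 t2 t3 /\ V <=
    level_mass f `[t1, t2].
Proof.
move=> [_ Gconn] L0 HV Hf.
have [m [M mM]] := edge_range_exists Hf.
have [es] : exists es : edge G, True.
  apply: contrapT => none; move: L0; rewrite /total_length big1 ?ltxx// => e _.
  by exfalso; apply: none; exists e.
move=> _.
have mleM e : m e <= M e.
  by have [r [t tI <-] _] := mM e; have /andP[] := r t tI.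
pose s := [seq m e | e : edge G] ++ [seq M e | e : edge G].
(* Between two consecutive breakpoints, an edge taking a level between them
   takes all of them. *)
have full x y e t : (forall z, z \in s -> ~~ (x < z < y)) ->
    0 <= t <= len e -> x < f e t < y -> m e <= x /\ y <= M e.
  move=> avoid tI /andP[xf fy]; have [r _ _] := mM e; have /andP[mf fM] := r t tI.
  split; rewrite leNgt; apply/negP => h.
  - have := avoid (m e); rewrite h (le_lt_trans mf fy) => /(_ _)/negP; apply => //.
    by rewrite mem_cat map_f// mem_enum.
  - have := avoid (M e); rewrite h (lt_le_trans xf fM) => /(_ _)/negP; apply => //.
    by rewrite mem_cat map_f ?orbT// mem_enum.
(* This serves all edges with [n = 1] and the doubly connected component with [n = 2]. The midpoint
   of a gap between breakpoints is attained on some edge, which then crosses the whole gap. *)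
have crossing A e0 n (mn Mx : R) e1 e2 :
    component A e0 e1 -> component A e0 e2 -> m e1 = mn -> M e2 = Mx ->
    (forall e x y p q, component A e0 e -> x <= y -> 0 <= p <= len e -> 0 <= q <=
      len e ->
       f e p <= x -> y <= f e q -> n * (y - x) <= level_variation f f' `]x, y[) ->
    crosses f f' n mn Mx.
  move=> c1 c2 E1 E2 H; apply: (crosses_breakpoints Hf (s := s)) =>
    x y mx xy yM avoid.
  have [_ [p pI fp] _] := mM e1; have [_ _ [q qI fq]] := mM e2.
  have [||e ce [t tI ft]] := component_level_attained Hf (z := (x +
    y) / 2) c1 c2 pI qI.
  - by rewrite fp E1; lra.
  - by rewrite fq E2; lra.
  have [mx' yM'] : m e <= x /\ y <= M e by apply: full avoid tI _; rewrite ft; lra.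
  have [_ [p' pI' fp'] [q' qI' fq']] := mM e.
  by apply: H ce (ltW xy) pI' qI' _ _; rewrite ?fp' ?fq'.
have all_conn e : component predT es e by rewrite /component /= Gconn.
have argm (P : pred (edge G)) e0 : P e0 -> exists2 e1, P e1 & forall e, P e ->
  m e1 <= m e.
  by move=> Pe0; case: (arg_minP m Pe0) => e1 P1 h; exists e1.
have argM (P : pred (edge G)) e0 : P e0 -> exists2 e1, P e1 & forall e, P e ->
  M e <= M e1.
  by move=> Pe0; case: (arg_maxP M Pe0) => e1 P1 h; exists e1.
have [a _ ha] := argm predT es isT; have [b _ hb] := argM predT es isT.
have range e t : 0 <= t <= len e -> m a <= f e t <= M b.
  move=> tI; have [r _ _] := mM e; have /andP[h1 h2] := r t tI.
  by rewrite (le_trans (ha e isT) h1) (le_trans h2 (hb e isT)).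
have cross1 : crosses f f' 1 (m a) (M b).
  apply: (crossing predT es) (all_conn a) (all_conn b) erefl erefl _.
  move=> e x y p q _ xy pI qI fp fq; rewrite mul1r.
  exact: le_trans (edge_variation_once Hf xy pI qI fp fq) (ler_edge_variation _ _ _ _ _).
case: HV => [[e0 d0 VE]|[_ V0]]; last first.
  (* Without cycles the band shrinks to a single value of [f], and the double crossing is
     vacuous. *)
  have I0 : 0 <= (0 : R) <= len es by rewrite lexx (ltW (len_gt0 es)).
  have /andP[r1 r2] := range es 0 I0.
  exists (m a), (f es 0), (f es 0), (M b); split; last by rewrite V0 level_mass_ge0.
  by split => // x' y' h1 h2 h3; exfalso; clear -h1 h2 h3; lra.
have ce0 : component (@doubly_connected _ G) e0 e0
  by rewrite /component d0 connect0.
have [a' ca' ha'] := argm _ _ ce0; have [b' cb' hb'] := argM _ _ ce0.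
exists (m a), (m a'), (M b'), (M b); split.
  split => //.
  - exact: ha.
  - by apply: le_trans (ha' _ ce0) (le_trans (mleM e0) (hb' _ ce0)).
  - exact: hb.
  - apply: (crossing _ e0) ca' cb' erefl erefl _.
    move=> e x y p q /andP[de _] xy pI qI fp fq.
    move: de => /asboolP[path sp ep].
    exact: (cycle_variation Hf xy sp ep pI qI fp fq).
(* On the edges of the component [f] stays in [[m a', M b']], so their full lengths, which sum to
   [V], are counted. *)
rewrite VE /level_mass /level_integral.
rewrite [leRHS](bigID (component (@doubly_connected _ G) e0))/=.
apply: ler_wpDr; first by apply: sumr_ge0 => *; exact: Rintegral_ge0.
apply: ler_sum => e ce.
have -> : edge_level f `[m a', M b'] e = `[0, len e]%classic.
  apply/seteqP; split => t; first by case.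
  move=> tI; split => //; move: tI; rewrite /= !in_itv /= => tI.
  have [r _ _] := mM e; have /andP[h1 h2] := r t tI.
  by rewrite (le_trans (ha' e ce) h1) (le_trans h2 (hb' e ce)).
by rewrite Rintegral_edge_length.
Qed.

(** * Test functions on the tadpole *)
Section Waves.
Context {R : realType}.
Notation mu := (@lebesgue_measure R).

Lemma is_derive_continuous (F F' : R -> R) : (forall t :
  R, is_derive t 1 F (F' t)) ->
  continuous F.
Proof.
move=> dF t; apply: differentiable_continuous; apply/derivable1_diffP.
by have [] := dF t.
Qed.

Lemma Rintegral_deriv (F F' : R -> R) (l : R) : 0 <= l -> continuous F' ->
  (forall t : R, is_derive t 1 F (F' t)) ->
  \int[mu]_(t in `[0, l]) F' t = F l - F 0.
Proof.
rewrite le_eqVlt => /predU1P[<-|l0] cF' dF.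
  by rewrite set_itv1 Rintegral_set1 subrr.
have cF := is_derive_continuous dF.
rewrite /Rintegral (@continuous_FTC2 _ F' F 0 l l0) //.
- exact: continuous_subspaceT.
- split.
  + by move=> t _; have [] := dF t.
  + exact: cvg_at_right_filter (cF 0).
  + exact: cvg_at_left_filter (cF l).
- by move=> t _; rewrite derive1E; have [_ ->] := dF t.
Qed.

Definition wave (A k phi t : R) : R := A * cos (k * t + phi).
Definition wave' (A k phi t : R) : R := - (k * A * sin (k * t + phi)).

Let is_derive_phase (k phi t : R) : is_derive t 1 (fun s => k * s + phi) k.
Proof. by apply: is_derive_eq; rewrite /GRing.scale /= mulr1 addr0. Qed.

Lemma is_derive_wave (A k phi t : R) :
  is_derive t 1 (wave A k phi) (wave' A k phi t).
Proof.
have := is_derive1_comp (is_derive_cos _) (is_derive_phase k phi t) => h.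
rewrite /wave; apply: is_derive_eq.
rewrite /GRing.scale /= /wave'; ring.
Qed.

Lemma is_derive_wave' (A k phi t : R) :
  is_derive t 1 (wave' A k phi) (- (k ^+ 2 * wave A k phi t)).
Proof.
have := is_derive1_comp (is_derive_sin _) (is_derive_phase k phi t) => h.
rewrite /wave'; apply: is_derive_eq.
rewrite /GRing.scale /= /wave; ring.
Qed.

Lemma continuous_wave (A k phi : R) : continuous (wave A k phi).
Proof. exact: is_derive_continuous (is_derive_wave A k phi). Qed.

Lemma continuous_wave' (A k phi : R) : continuous (wave' A k phi).
Proof. exact: is_derive_continuous (is_derive_wave' A k phi). Qed.

Lemma continuous_segment_integrable (F : R -> R) (l : R) : continuous F ->
  mu.-integrable `[0, l] (EFin \o F).
Proof.
move=> cF; apply: continuous_compact_integrable; first exact: segment_compact.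
exact: continuous_subspaceT.
Qed.

Lemma continuous_sqr (F : R -> R) : continuous F -> continuous (fun t => F t ^+ 2).
Proof.
move=> cF t; rewrite (_ : (fun t => F t ^+ 2) = (fun t => F t * F t)).
  by apply: cvgM; exact: cF.
by apply/funext => z; rewrite expr2.
Qed.

Lemma wave_H1 (A k phi l : R) : H1_interval l (wave A k phi) (wave' A k phi).
Proof.
split.
- apply: measurable_funS (@measurableT _ _) (@subsetT _ _) _.
  by apply: continuous_measurable_fun; exact: continuous_wave'.
- exact: (continuous_segment_integrable l (continuous_sqr (@continuous_wave' A k phi))).
- move=> x; rewrite in_itv /= => /andP[x0 _].
  by rewrite (Rintegral_deriv x0 (@continuous_wave' A k phi) (is_derive_wave A k phi)) subrKC.
Qed.

Lemma wave_integral (A k phi l : R) : 0 <= l ->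
  k ^+ 2 * \int[mu]_(t in `[0, l]) wave A k phi t =
  wave' A k phi 0 - wave' A k phi l.
Proof.
move=> l0; rewrite -RintegralZl//;
  last exact: continuous_segment_integrable (@continuous_wave A k phi).
have dF (t : R) : is_derive t 1 (fun t =>
  - wave' A k phi t) (k ^+ 2 * wave A k phi t).
  by have h := is_derive_wave' A k phi t; apply: is_derive_eq; rewrite opprK.
have cF : continuous (fun t => k ^+ 2 * wave A k phi t).
  by move=> t; apply: cvgMr; exact: continuous_wave.
by rewrite (Rintegral_deriv l0 cF dF); ring.
Qed.

Lemma wave_energy (A k phi l : R) : 0 <= l ->
  \int[mu]_(t in `[0, l]) (wave' A k phi t ^+ 2) =
  k ^+ 2 * \int[mu]_(t in `[0, l]) (wave A k phi t ^+ 2) +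
  (wave A k phi l * wave' A k phi l - wave A k phi 0 * wave' A k phi 0).
Proof.
move=> l0.
have c1 := continuous_sqr (@continuous_wave A k phi).
have c2 := continuous_sqr (@continuous_wave' A k phi).
have i1 := continuous_segment_integrable l c1.
have i2 := continuous_segment_integrable l c2.
have c3 : continuous (fun t => k ^+ 2 * wave A k phi t ^+ 2).
  by move=> t; apply: cvgMr; exact: c1.
have i3 := continuous_segment_integrable l c3.
rewrite -RintegralZl//; apply/eqP; rewrite addrC -subr_eq -RintegralB//; apply/eqP.
have dF (t : R) : is_derive t 1 (fun t => wave A k phi t * wave' A k phi t)
    (wave' A k phi t ^+ 2 - k ^+ 2 * wave A k phi t ^+ 2).
  have h := is_derive_wave A k phi t; have h' := is_derive_wave' A k phi t.
  by apply: is_derive_eq; rewrite /GRing.scale /=; ring.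
have cF : continuous (fun t => wave' A k phi t ^+ 2 - k ^+ 2 * wave A k phi t ^+ 2).
  by move=> t; apply: cvgB; [exact: c2|exact: c3].
exact: Rintegral_deriv l0 cF dF.
Qed.
End Waves.

(** * Rayleigh quotients *)

Section Rayleigh.
Context {R : realType}.
Notation mu := (@lebesgue_measure R).

Lemma rayleigh_quotients_ge0 (G : metric_graph R) (r : R) :
  rayleigh_quotients G r -> 0 <= r.
Proof.
move=> [f [f' [_ _ _ ->]]]; apply: divr_ge0; apply: sumr_ge0 => e _;
  by apply: Rintegral_ge0 => t _; exact: sqr_ge0.
Qed.

Lemma lambda2_le (G : metric_graph R) (r : R) : rayleigh_quotients G r ->
  lambda2 G <= r.
Proof.
by move=> Gr; apply: ge_inf => //; exists 0 => s /rayleigh_quotients_ge0.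
Qed.

(** Integration by parts leaves only end terms on each edge; when these cancel in total, the mean is
    0 and the energy is [k ^+ 2] times the square. The vertex conditions thus enter as continuity
    and two sums. *)
Lemma lambda2_le_wave (G : metric_graph R) (A phi : edge G -> R) (k : R) : 0 < k ->
  (exists u : vert G -> R, forall e, wave (A e) k (phi e) 0 = u (src e) /\
     wave (A e) k (phi e) (len e) = u (tgt e)) ->
  \sum_e (wave' (A e) k (phi e) 0 - wave' (A e) k (phi e) (len e)) = 0 ->
  \sum_e (wave (A e) k (phi e) (len e) * wave' (A e) k (phi e) (len e) -
          wave (A e) k (phi e) 0 * wave' (A e) k (phi e) 0) = 0 ->
  (exists e, exists2 x, x \in `[0, len e] & wave (A e) k (phi e) x != 0) ->
  lambda2 G <= k ^+ 2.
Proof.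
move=> k0 Hu mean bnd nz.
pose f e := wave (A e) k (phi e); pose f' e := wave' (A e) k (phi e).
have E : graph_integral (fun e t => f' e t ^+ 2) =
    k ^+ 2 * graph_integral (fun e t => f e t ^+ 2).
  apply/eqP; rewrite -subr_eq0 /graph_integral mulr_sumr -sumrB; apply/eqP.
  apply: etrans bnd; apply: eq_bigr => e _; rewrite wave_energy; last
    by rewrite ltW// len_gt0.
  by rewrite addrC addKr.
apply: (@le_trans _ _ (graph_integral (fun e t => f' e t ^+ 2) /
    graph_integral (fun e t => f e t ^+ 2))).
  apply: lambda2_le; exists f, f'; split => //.
  - by split => // e; exact: wave_H1.
  - apply: (mulfI (_ : k ^+ 2 != 0)); first by rewrite expf_neq0// gt_eqF.
    rewrite mulr0 /graph_integral mulr_sumr; apply: etrans mean;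
      apply: eq_bigr => e _.
    by rewrite wave_integral// ltW// len_gt0.
(* A vanishing denominator makes the quotient 0 by convention, which respects the bound. *)
rewrite E; have [->|nz0] := eqVneq (graph_integral (fun e t => f e t ^+ 2)) 0.
  by rewrite invr0 mulr0 sqr_ge0.
by rewrite mulfK.
Qed.

(** One full period of a sine on a single edge, extended by zero, has mean zero and vanishes at the
    vertices. Lower bounds pass to the infimum only for a nonempty set. *)
Lemma rayleigh_quotients_nonempty (G : metric_graph R) (e0 : edge G) :
  rayleigh_quotients G !=set0.
Proof.
pose l := len e0; have l0 : 0 < l by exact: len_gt0.
pose k := 2 * pi / l; pose A e : R := (e == e0)%:R; pose phi : R := - (pi / 2).
have pi0 := pi_gt0 R.
have k0 : 0 < k by rewrite divr_gt0// mulr_gt0.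
have c0 : cos phi = 0 :> R by rewrite cosN cos_pihalf.
have kl : k * l + phi = phi + pi *+ 2 by rewrite /k divfK ?gt_eqF// mulr2n; ring.
eexists; exists (fun e => wave (A e) k phi), (fun e => wave' (A e) k phi); split.
- split; first by move=> e; exact: wave_H1.
  exists (fun=> 0) => e; rewrite /wave mulr0 add0r c0 mulr0; split => //.
  rewrite /A; have [->|_] := eqVneq e e0; last by rewrite mul0r.
  by rewrite -/l kl cosD2pi c0 mulr0.
- exists e0, (l / 4); first by rewrite in_itv /= -/l; lra.
  rewrite /wave /A eqxx mul1r (_ : k * (l / 4) + phi = 0); first
    by rewrite cos0 oner_neq0.
  by rewrite /k /phi; field; rewrite gt_eqF.
- rewrite /graph_integral big1// => e _.
  apply: (mulfI (_ : k ^+ 2 != 0)); first by rewrite expf_neq0// gt_eqF.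
  rewrite mulr0 wave_integral; last by rewrite ltW// len_gt0.
  rewrite /wave' /A; have [->|_] := eqVneq e e0; last by rewrite mulr0 !mul0r subrr.
  by rewrite -/l kl sinD2pi mulr0 add0r subrr.
- by [].
Qed.

(** By continuity [|f e|] is at least half of [|f e x|] on a nondegenerate interval, taken to the
    right of [x], or to its left if [x] is the right end of the edge. *)
Lemma graph_integral_sqr_gt0 (G : metric_graph R) (f f' : edge G -> R -> R) :
  H1_graph f f' -> (exists e, exists2 x, x \in `[0, len e] & f e x != 0) ->
  0 < graph_integral (fun e t => f e t ^+ 2).
Proof.
move=> Hf [e [x xI fx]].
apply: (@lt_le_trans _ _ (\int[mu]_(t in `[0, len e]) (f e t ^+ 2))); last first.
  rewrite /graph_integral (bigD1 e)//= lerDl; apply: sumr_ge0 => *.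
  by apply: Rintegral_ge0 => t _; exact: sqr_ge0.
have l0 := len_gt0 e.
have cf := (subspace_continuousP _ _).1 (@edge_continuous _ _ _ _ Hf e) x xI.
have v0 : 0 < `|f e x| / 2 by rewrite divr_gt0// normr_gt0.
move/cvgrPdist_lt : cf => /(_ _ v0).
rewrite /within /from_subspace /= => -[d /= d0 near].
have {}near y : 0 <= y <= len e -> `|x - y| < d -> (f e x / 2) ^+ 2 <= f e y ^+ 2.
  move=> yI yd; have := near y yd; rewrite in_itv /= yI => /(_ isT) h.
  rewrite -[leRHS]real_normK ?num_real// -[leLHS]real_normK ?num_real//.
  rewrite normrM [`|2^-1|]ger0_norm//.
  have := ler_normD (f e x - f e y) (f e y); rewrite subrK => h2.
  by apply: lerXn2r; rewrite ?nnegrE ?mulr_ge0//; lra.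
rewrite in_itv /= in xI; move: xI => /andP[x0 xl].
have [a [b [a0 ab bl near_ab]]] : exists a b, [/\ 0 <= a, a < b, b <= len e &
    forall y, a <= y <= b -> `|x - y| < d].
  have [h|h] := ltP x (len e).
  - exists x, (Num.min (x + d / 2) (len e)); split => //.
    + by rewrite lt_min h andbT ltrDl divr_gt0.
    + by rewrite ge_min lexx orbT.
    + move=> y; rewrite le_min => /andP[xy /andP[yd _]].
      by rewrite distrC ger0_norm ?subr_ge0//; lra.
  - exists (Num.max (x - d / 2) 0), x; split => //.
    + by rewrite le_max lexx orbT.
    + by rewrite gt_max (lt_le_trans l0 h) andbT gtrBl divr_gt0.
    + move=> y; rewrite ge_max => /andP[/andP[yd _] yx].
      by rewrite ger0_norm ?subr_ge0//; lra.
have mab : measurable (`[a, b] : set R) by exact: measurable_itv.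
have sub : `[a, b] `<=` `[0, len e] by apply: subset_itv; rewrite bnd_simp.
have int := @edge_integrable_fun2 _ _ _ _ Hf e.
apply: (@lt_le_trans _ _ (\int[mu]_(t in `[a, b]) ((f e x / 2) ^+ 2))).
  have mE : mu `[a, b] = (b - a)%:E by rewrite lebesgue_measure_itv /= lte_fin ab.
  rewrite Rintegral_cst// (_ : fine _ = b - a); last
    by rewrite -[RHS]/(fine (b - a)%:E); congr fine.
  rewrite mulr_gt0 ?subr_gt0// exprn_even_gt0//= mulf_neq0//.
apply: (@le_trans _ _ (\int[mu]_(t in `[a, b]) (f e t ^+ 2))).
  apply: le_Rintegral => //.
  - apply: continuous_compact_integrable; first exact: segment_compact.
    by apply: continuous_subspaceT => ?; exact: cvg_cst.
  - exact: integrableS int.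
  - move=> t tab; apply: near; last by apply: near_ab; move: tab; rewrite /= in_itv.
    by have := sub _ tab; rewrite /= in_itv.
by apply: ge0_subset_Rintegral => // t _; exact: sqr_ge0.
Qed.

End Rayleigh.

(** * Comparison with the tadpole *)

Section Final.
Context {R : realType}.

(** On a proper tadpole the test function consists of cosines of frequency [k], centred at the free
    end of the pendant edge and at the midpoint of the loop. *)
Lemma lambda2_tadpole_le (L V : R) (L0 : 0 < L) (VL : 0 <= V <= L) (k : R) :
  0 < k ->
  half_phase (k * (L - V)) + k * V / 2 = pi ->
  lambda2 (tadpole L0 VL) <= k ^+ 2.
Proof.
move=> k0 hk; set x := k * (L - V) in hk; set h := k * V / 2 in hk.
(* The equation [half_phase x = pi - h] amounts to [tan x = - 2 * tan h], written here without
   denominators. *)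
have secular : 2 * sin h * cos x = - (cos h * sin x).
  have := half_phaseE x; have -> : half_phase x = pi - h by lra.
  by rewrite sinB cosB sinpi cospi; lra.
rewrite /tadpole; case: eqVneq => [V0|Vn0].
  have sx : sin x = 0.
    by move: secular; rewrite /h V0 mulr0 mul0r sin0 cos0 mulr0 mul0r mul1r =>
      /esym/eqP; rewrite oppr_eq0 => /eqP.
  rewrite /x V0 subr0 in sx.
  apply: (@lambda2_le_wave _ (path_graph L0) (fun=> 1) (fun=> 0)) => //.
  - exists (fun b => if b then cos (k * L) else 1) => e.
    by rewrite /wave mulr0 !addr0 cos0 !mul1r.
  - by rewrite big1// => e _; rewrite /wave' /= mulr0 !addr0 sx sin0 subrr.
  - by rewrite big1// => e _;
    rewrite /wave /wave' /= mulr0 !addr0 sx sin0 !(mulr0, oppr0, addr0).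
  - exists tt, 0; first by rewrite in_itv /= lexx ltW.
    by rewrite /wave mulr0 addr0 cos0 mulr1 oner_neq0.
case: eqVneq => [VEL|VnL].
  have kL : k * L = pi *+ 2.
    have hL : k * L / 2 = pi.
      by rewrite -hk /x /h VEL subrr mulr0 half_phase0 add0r.
    by rewrite mulr2n; lra.
  apply: (@lambda2_le_wave _ (loop_graph L0) (fun=> 1) (fun=> 0)) => //.
  - exists (fun=> 1) => e.
    by rewrite /wave mulr0 !addr0 cos0 /= kL cos2pi !mulr1.
  - by rewrite big1// => e _; rewrite /wave' /= mulr0 !addr0 kL sin2pi sin0 subrr.
  - by rewrite big1// => e _;
    rewrite /wave /wave' /= mulr0 !addr0 kL sin2pi sin0 !(mulr0, oppr0, addr0).
  - exists tt, 0; first by rewrite in_itv /= lexx ltW.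
    by rewrite /wave mulr0 addr0 cos0 mulr1 oner_neq0.
have V0 : 0 < V by exact: tadpole_loop_gt0 VL Vn0.
have p0 : 0 < L - V by exact: tadpole_edge_gt0 VL VnL.
(* The amplitudes [c1] on the edge and [c2] on the loop must satisfy continuity and the balance of
   derivatives at the junction. For [cos h] and [cos x] the balance is [secular]; if both cosines
   vanish, continuity is void and the balance alone determines the amplitudes up to a factor. *)
have [c1 [c2 [E1 E2 nz]]] : exists c1 c2 : R, [/\ c1 * cos x = c2 * cos h,
    c1 * sin x + 2 * c2 * sin h = 0 & (c1 != 0) || (c2 * cos 0 != 0)].
  have [/andP[/eqP cx /eqP ch]|ncc] := boolP ((cos x == 0) && (cos h == 0)).
    exists (2 * sin h), (- sin x); split.
    - by rewrite cx ch !mulr0.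
    - by ring.
    - apply/orP; left; rewrite mulf_neq0 ?pnatr_eq0//; apply/eqP => sh.
      by have := cos2Dsin2 h; rewrite ch sh expr0n addr0 => /eqP;
        rewrite eq_sym oner_eq0.
  exists (cos h), (cos x); split; first by rewrite mulrC.
  - by rewrite mulrAC [cos h * _]mulrC; lra.
  - by rewrite cos0 mulr1; move: ncc; rewrite negb_and orbC.
pose A (e : bool) := if e then c2 else c1.
pose phi (e : bool) := if e then - h else - x.
have kVh : k * V + - h = h by rewrite /h; field.
have kpx : k * (L - V) + - x = 0 by rewrite /x subrr.
apply: (@lambda2_le_wave _ (proper_tadpole _ _) A phi) => //.
- exists (fun b : bool => if b then c1 else c1 * cos x) => -[];
  rewrite /wave /A /phi /= mulr0 add0r cosN.
  + by rewrite kVh E1.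
  + by rewrite kpx cos0 mulr1.
- rewrite big_bool /wave' /A /phi /= !mulr0 !add0r !sinN kVh kpx sin0.
  transitivity (k * (c1 * sin x + 2 * c2 * sin h)); first by ring.
  by rewrite E2 mulr0.
- rewrite big_bool /wave /wave' /A /phi /= !mulr0 !add0r !sinN !cosN kVh kpx sin0.
  transitivity (- (k * ((c2 * cos h) * (2 * c2 * sin h) +
    (c1 * cos x) * (c1 * sin x)))).
    by ring.
  rewrite E1 -mulrDr (addrC (2 * _ * _)) E2 !mulr0 oppr0//.
- move: nz => /orP[nz|nz].
  + exists false, (L - V); first by rewrite in_itv /= lexx ltW.
    by rewrite /wave /A /phi kpx cos0 mulr1.
  + exists true, (V / 2); first by rewrite in_itv /=; lra.
    by rewrite /wave /A /phi (_ : k * (V / 2) + - h = 0)// /h; field.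
Qed.

(** This lets the estimate be proved for [k' < k], where the phase stays strictly below [pi]. Were
    [k ^+ 2 * D > N], the midpoint of the square root of [N / D] and [k] would be a
    counterexample. *)
Lemma sqr_le_limit (k D N : R) : 0 < k -> 0 < D -> 0 <= N ->
  (forall k', 0 < k' -> k' < k -> k' ^+ 2 * D <= N) -> k ^+ 2 * D <= N.
Proof.
move=> k0 D0 N0 H; rewrite leNgt; apply/negP => ND.
pose s := Num.sqrt (N / D); have s0 : 0 <= s by exact: sqrtr_ge0.
have s2 : s ^+ 2 * D = N by rewrite sqr_sqrtr ?divr_ge0 ?(ltW D0)// divfK ?gt_eqF.
have sk : s < k.
  rewrite -(@ltr_pXn2r _ 2)// ?nnegrE ?(ltW k0)//.
  by rewrite -(ltr_pM2r D0) s2.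
have := H ((s + k) / 2) ltac:(lra) ltac:(lra); rewrite -s2 ler_pM2r//.
by rewrite ler_pXn2r ?nnegrE//; lra.
Qed.

(** The cross term is a multiple of the mean and vanishes, so a shift only adds the integral of
    [c ^+ 2]. Hence the inequality for any zero level bounds the Rayleigh quotient. *)
Lemma mean_zero_shift (G : metric_graph R) (f f' : edge G -> R -> R) (c : R) :
  H1_graph f f' -> graph_integral f = 0 ->
  graph_integral (fun e t => f e t ^+ 2) <=
  graph_integral (fun e t => graph_shift f c e t ^+ 2).
Proof.
move=> Hf mean.
have i1 := edge_integrable_fun Hf; have i2 := edge_integrable_fun2 Hf.
have i3 := edge_integrableZ (- 2 * c) i1.
have i4 := edge_integrable_cst (G := G) (c ^+ 2).
rewrite !(graph_integralE f).
have -> : (fun e t => graph_shift f c e t ^+ 2) =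
    (fun e t => f e t ^+ 2 + (- 2 * c * f e t + c ^+ 2)).
  by apply/funext => e; apply/funext => t; rewrite /graph_shift; ring.
rewrite (level_integralD Hf)//; last exact: edge_integrableD.
rewrite (level_integralD Hf)// (level_integralZ Hf)//.
rewrite -(graph_integralE f f) mean mulr0 add0r lerDl.
by apply: level_integral_ge0 => e t; exact: sqr_ge0.
Qed.

End Final.

Theorem theorem6p5 (R : realType) (G : metric_graph R) (L V : R)
    (G_connected : connected_graph G)
    (G_length : total_length G = L)
    (L_gt0 : 0 < L)
    (V_itv : 0 <= V <= L)
    (V_component : doubly_connected_component_length G V) :
  lambda2 G >= lambda2 (tadpole L_gt0 V_itv).
Proof.
have /andP[V0 VL] := V_itv.
have [k k0 hk] : exists2 k : R, 0 < k & half_phase (k * (L - V)) + k * V / 2 = pi.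
  by apply: half_phase_root_exists => //; rewrite ?subr_ge0// subrK.
apply: le_trans (lambda2_tadpole_le _ _ k0 hk) _.
have [e0] : exists e0 : edge G, True.
  apply: contrapT => none; move: L_gt0;
    rewrite -G_length /total_length big1 ?ltxx// => e _.
  by exfalso; apply: none; exists e.
move=> _; apply: lb_le_inf; first exact: rayleigh_quotients_nonempty e0.
move=> _ [f [f' [Hf nz mean ->]]].
have den := graph_integral_sqr_gt0 Hf nz.
have num : 0 <= graph_integral (fun e t => f' e t ^+ 2).
  by apply: sumr_ge0 => e _; apply: Rintegral_ge0 => t _; exact: sqr_ge0.
rewrite ler_pdivlMr//; apply: sqr_le_limit => // k' k'0 k'k.
have L0 : 0 < total_length G by rewrite G_length.
have [t0 [t1 [t2 [t3 [P VC]]]]] := graph_profile G_connected L0 V_component Hf.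
(* Between [k'] and [k] the edge gains at least [(k - k') * (L - V) / 2] of phase by the slope
   bound; with [(k - k') * V / 2] from the loop the total gain is positive whatever [V] is. *)
have phase : half_phase (k' * (total_length G - V)) + k' * V / 2 < pi.
  rewrite G_length -hk.
  have h1 : k' * (L - V) <= k * (L - V) by apply: ler_wpM2r;
    [rewrite subr_ge0|exact: ltW].
  have h2 : k' * L < k * L by rewrite ltr_pM2r.
  by have := ler_half_phase h1; rewrite !mulrBr; clear -h2; lra.
have [c] := poincare_tadpole P k'0 V0 VC phase.
rewrite subr_ge0 /level_square /level_energy -!graph_integralE => hc.
apply: le_trans hc; rewrite ler_wpM2l ?sqr_ge0//.
exact: mean_zero_shift Hf mean.
Qed.
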